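(* Let $p\in[1,2)$ and let $E:=\ell^p(\mathbb{N})$ be the real sequence space. Let $(\omega_n)_{n\ge0}$ be a positive weight sequence such that the sequence $(\lambda_n)_{n\ge0}$ defined by $\lambda_0>0$ and $$\lambda_n:=\lambda_0\prod_{l=0}^{n-1}\frac1{\omega_l},\quad n\ge0,$$ satisfies $(\lambda_n)_{n\ge0}\in\ell^p(\mathbb{N})$. Let $\mu$ be the compound Poisson measure on $E$ with characteristic functional $$\int_E e^{i\langle z,x^*\rangle}\mu(dz)=\exp\Big(i\langle\hat x,x^*\rangle+\int_E\big(e^{i\langle z,x^*\rangle}-1-i\kappa(z)\langle z,x^*\rangle\big)\lambda(dz)\Big),\quad x^*\in E^*,$$ where $$\hat x:=\sum_{n=0}^\infty\lambda_ne_n,\qquad \kappa(z):=\mathbf{1}_{\{\|z\|_{\ell^p(\mathbb{N})}\le\max_{n\ge0}\lambda_n\}},\qquad \lambda(dz):=\sum_{n=0}^\infty\delta_{\lambda_ne_n}(dz).$$ Consider the weighted backward shift operator $T$ on $E$ defined by $Te_0:=0$ and $Te_{n+1}:=\omega_ne_n$, $n\ge0$, assumed to be bounded. Then: 1. $T$ admits $\mu$ as invariant measure. 2. For all $n\ge0$, $$\sup_{x^*,y^*\in E^*\setminus\{0\}}\frac{|C_\mu^{=}(x^*,T^{*n}y^* )|}{\|x^*\|^{p/2}\|y^*\|^{p/2}}\le2^{4-p}\sum_{l=0}^\infty(\lambda_l\lambda_{l+n})^{p/2}.$$ In particular, $T$ is mixing with respect to $\mu$ provided that $\lim_{n\to\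infty}\sum_{l=0}^\infty(\lambda_l\lambda_{l+n})^{p/2}=0$.
   Context: $(e_n)_{n\ge0}$ is the canonical basis of $\ell^p(\mathbb{N})$, $\delta_x$ the Dirac measure at $x$, $\langle\cdot,\cdot\rangle$ the duality between $E$ and its continuous dual $E^*$, and $T^*$ the adjoint, $\langle z,T^*x^*\rangle=\langle Tz,x^*\rangle$. Codifference (on a real space): for $x^*,y^*\in E^*$, $$C^{=}_\mu(x^*,y^* ):=\log\int_E e^{i\langle z,x^*-y^*\rangle}\mu(dz)-\log\int_E e^{i\langle z,x^*\rangle}\mu(dz)-\log\int_E e^{-i\langle z,y^*\rangle}\mu(dz),$$ where $\log$ of the characteristic functional is its Lévy–Khintchine exponent (the continuous logarithm vanishing at $x^*=0$). $T$ admits $\mu$ as invariant measure if $\mu(T^{-1}(A))=\mu(A)$ for all Borel $A\subset E$. $T$ is mixing if $\lim_{n\to\infty}\mu(A\cap T^{-n}(B))=\mu(A)\mu(B)$ for all Borel $A,B\subset E$. *)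

(* Defs.v *)
From HB Require Import structures.
From mathcomp Require Import all_boot all_order all_algebra.
From mathcomp Require Import finmap complex.
From mathcomp Require Import all_classical all_reals all_analysis.

Set Implicit Arguments.
Unset Strict Implicit.
Unset Printing Implicit Defensive.

Import Order.TTheory GRing.Theory Num.Theory.
Import numFieldNormedType.Exports.

Local Open Scope classical_set_scope.
Local Open Scope ring_scope.

Section ell_p.
Context (R : realType).

Definition nat_counting : {measure set nat -> \bar R} := counting.

Context (p : R) (p1 : 1 <= p).

Lemma ellp_exponent_ge1 : (1 <= p%:E)%E. Proof. by rewrite lee_fin. Qed.

(* Every subset of nat is measurable, so an element of the type below is just
   a sequence with finite p-norm (see Lnorm_counting); no quotient is needed
   because only the empty set is null for the counting measure. *)
Definition ellp : Type := LfunType nat_counting ellp_exponent_ge1.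

HB.instance Definition _ := GRing.Lmodule.on ellp.

Definition ellp_norm (x : ellp) : R :=
  fine ('N[nat_counting]_(p%:E)[EFin \o (x : nat -> R)])%E.

Let ellp_normD (x y : ellp) : ellp_norm (x + y) <= ellp_norm x + ellp_norm y.
Proof. exact: ler_LnormD. Qed.

Let ellp_normZ (a : R) (x : ellp) : ellp_norm (a *: x) = `|a| * ellp_norm x.
Proof.
apply/EFin_inj; rewrite EFinM /ellp_norm !finite_norm_fine; exact: LnormZ.
Qed.

Let ellp_norm_eq0 (x : ellp) : ellp_norm x = 0 -> x = 0.
Proof.
move=> /fine_Lnormr_eq0 [N [_ N0 xN]]; apply/LfuneqP => n.
apply: contrapT => xn0.
have Nn : N n by apply: xN => /= h; apply: xn0; exact: h.
have : (nat_counting [set n] <= nat_counting N)%E by apply: le_measure;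
  rewrite ?inE// => _ ->.
by rewrite N0 /nat_counting/= /counting asboolT// fset_set1 cardfs1 lee_fin ler10.
Qed.

HB.instance Definition _ := Lmodule_isNormed.Build R ellp
  ellp_normD ellp_normZ ellp_norm_eq0.

Lemma ellp_basis_subproof (n : nat) :
  (fun k => (k == n)%:R : R) \in Lfun nat_counting p%:E.
Proof.
apply/andP; split; rewrite inE/=; first by [].
rewrite /finite_norm Lnorm_counting; last exact: (lt_le_trans ltr01 p1).
apply: poweR_lty.
rewrite (nneseries_split 0 n.+1)//; last by move=> k _; exact: poweR_ge0.
rewrite eseries0 ?adde0.
  by apply/lte_sum_pinfty => k _; rewrite poweR_lty// ltry.
move=> k; rewrite add0n => nk _ /=; rewrite gt_eqF//= normr0.
by rewrite powR0 // gt_eqF // (lt_le_trans ltr01 p1).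
Qed.

Definition ellp_basis (n : nat) : ellp := Lfun_Sub _ (ellp_basis_subproof n).

End ell_p.

Section dual.
Context (R : realType) (V : normedModType R).

Definition in_dual : {pred V -> R} :=
  mem [set f : V -> R | scalar f /\ continuous f].

Lemma in_dual_submod_closed : submod_closed in_dual.
Proof.
split.
  rewrite inE; split; first by move=> a x y /=; rewrite mulr0 addr0.
  exact: cst_continuous.
move=> a f g; rewrite !inE => -[lf cf] [lg cg]; split.
  move=> b x y; rewrite !fctE /= lf lg.
  by rewrite -![a *: _]/(a * _) mulrDr mulrDr mulrCA addrACA.
move=> x; apply: cvgD; last exact: cg.
by apply: cvgZl_tmp; exact: cf.
Qed.

HB.instance Definition _ :=
  GRing.isSubmodClosed.Build R (V -> R) in_dual in_dual_submod_closed.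

Record dual := Dual { dual_fun :> V -> R; dual_funP : dual_fun \in in_dual }.

HB.instance Definition _ := [isSub for dual_fun].
HB.instance Definition _ := [Choice of dual by <:].
HB.instance Definition _ := [SubChoice_isSubLmodule of dual by <:].

Definition dual_norm (f : dual) : R := sup [set `|f x| | x in [set x | `|x| <= 1]].

HB.instance Definition _ (f : dual) :=
  GRing.isLinear.Build R V R _ f (proj1 (set_mem (dual_funP f))).

Let dual_bounded (f : dual) :
  has_ubound [set `|f x| | x in [set x : V | `|x| <= 1]].
Proof.
have /set_mem [_ cf] := dual_funP f.
have /linear_bounded_continuous/linear_boundedP := cf.
case/pinfty_ex_gt0 => M M0 fM; exists M => _ [x /= x1 <-].
by rewrite (le_trans (fM x))// ler_piMr// ltW.
Qed.

Let dual_unit_nonempty (f : dual) : [set `|f x| | x in [set x : V | `|x| <= 1]] !=set0.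
Proof. by exists `|f 0|, 0 => //=; rewrite normr0. Qed.

Let dual_norm_ge (f : dual) (x : V) : `|x| <= 1 -> `|f x| <= dual_norm f.
Proof. by move=> x1; apply: ub_le_sup => //; exists x. Qed.

Let dual_normD (f g : dual) : dual_norm (f + g) <= dual_norm f + dual_norm g.
Proof.
apply: ge_sup => // _ [x x1 <-].
by rewrite (le_trans (ler_normD _ _))// lerD// dual_norm_ge.
Qed.

Let dual_normZ_le (a : R) (f : dual) : dual_norm (a *: f) <= `|a| * dual_norm f.
Proof.
apply: ge_sup => // _ [x x1 <-].
by rewrite normrZ ler_wpM2l// dual_norm_ge.
Qed.

Let dual_normZ (a : R) (f : dual) : dual_norm (a *: f) = `|a| * dual_norm f.
Proof.
apply/eqP; rewrite eq_le dual_normZ_le/=.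
have [->|a0] := eqVneq a 0.
  rewrite normr0 mul0r; apply: le_trans (normr_ge0 ((0 *: f) 0)) _.
  by apply: dual_norm_ge; rewrite normr0.
rewrite -ler_pdivlMl ?normr_gt0// -normfV.
by apply: le_trans (dual_normZ_le _ _); rewrite scalerA mulVf// scale1r.
Qed.

Let dual_norm_eq0 (f : dual) : dual_norm f = 0 -> f = 0.
Proof.
move=> f0; apply/val_inj/funext => x; change (f x = 0).
have [->|x0] := eqVneq x 0; first by rewrite linear0.
have : `|f (`|x|^-1 *: x)| <= 0.
  by rewrite -f0 dual_norm_ge// normrZ normfV normr_id mulVf// normr_eq0.
rewrite linearZ/= normr_le0 mulf_eq0 invr_eq0 normr_eq0 (negPf x0)/=.
by move/eqP.
Qed.

HB.instance Definition _ := Lmodule_isNormed.Build R dual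
  dual_normD dual_normZ dual_norm_eq0.

Lemma adjoint_subproof (T : {linear V -> V}) (cT : continuous T) (f : dual) :
  (fun x => f (T x)) \in in_dual.
Proof.
have /set_mem [lf cf] := dual_funP f.
apply/mem_set; split; first by move=> a x y; rewrite linearP lf.
by move=> x; apply: continuous_comp; [exact: cT|exact: cf].
Qed.

Definition adjoint (T : {linear V -> V}) (cT : continuous T) (f : dual) : dual :=
  Dual (adjoint_subproof cT f).

End dual.

Section measures.
Context (R : realType) (V : normedModType R).

Definition borel : Type := g_sigma_algebraType (@open V).

HB.instance Definition _ := Measurable.on borel.

Definition invariant_measure (mu : probability borel R) (T : V -> V) : Prop :=
  forall A : set borel, measurable A -> mu (T @^-1` A) = mu A.

Definition mixing (mu : probability borel R) (T : V -> V) : Prop :=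
  forall A B : set borel, measurable A -> measurable B ->
    mu (A `&` iter n T @^-1` B) @[n --> \oo] --> (mu A * mu B)%E.

Definition sum_dirac (a : nat -> borel) : {measure set borel -> \bar R} :=
  mseries (fun n => \d_(a n)) 0.

Local Open Scope complex_scope.

Definition cexp (z : R[i]) : R[i] :=
  (expR (complex.Re z) * cos (complex.Im z)) +i*
  (expR (complex.Re z) * sin (complex.Im z)).

Definition cintegral (m : {measure set borel -> \bar R}) (f : V -> R[i]) : R[i] :=
  (\int[m]_z complex.Re (f z))%R +i* (\int[m]_z complex.Im (f z))%R.

Definition charfun (mu : probability borel R) (f : dual V) : R[i] :=
  cintegral mu (fun z => cexp (0 +i* f z)).

Definition levy_khintchine (xhat : V) (kappa : V -> R)
    (lambda : {measure set borel -> \bar R}) (f : dual V) : R[i] :=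
  (0 +i* f xhat) +
  cintegral lambda
    (fun z => cexp (0 +i* f z) - 1 - (0 +i* (kappa z * f z))).

(* The logarithm of a characteristic functional is not the principal one but
   its continuous determination on the dual vanishing at 0; it is unique when
   it exists since the dual is connected. *)
Definition is_continuous_log (phi psi : dual V -> R[i]) : Prop :=
  [/\ continuous (psi : dual V -> R[i]^o), psi 0 = 0 & forall f, cexp (psi f) = phi f].

Definition continuous_log (phi : dual V -> R[i]) : dual V -> R[i] :=
  xget (fun=> 0) [set psi | is_continuous_log phi psi].

(* psi (- g) is the logarithm of the integral of exp (- i <z, g>). *)
Definition codifference (mu : probability borel R) (f g : dual V) : R[i] :=
  let psi := continuous_log (charfun mu) in psi (f - g) - psi f - psi (- g).

End measures.

(* Main.v *)
Require Import Defs.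
From HB Require Import structures.
From mathcomp Require Import all_boot all_order all_algebra.
From mathcomp Require Import finmap complex.
From mathcomp Require Import all_classical all_reals all_analysis.
From mathcomp Require Import measurable_realfun.
From mathcomp Require Import ring lra.

Set Implicit Arguments.
Unset Strict Implicit.
Unset Printing Implicit Defensive.

Import Order.TTheory GRing.Theory Num.Theory.
Import numFieldNormedType.Exports.

Local Open Scope classical_set_scope.
Local Open Scope ring_scope.

(** Write N_n(z) = z_n / lam n ([jump_count]). As mu is compound Poisson with
    jumps lam n e_n, each at rate 1, the N_n ought to be independent Poisson
    variables of mean 1, where N_n counts the jumps along e_n. The definition of
    lam amounts to lam (n + 1) * omega n = lam n, that is, N_n (T z) =
    N_(n + 1) z: in these coordinates T is a one-sided Bernoulli shift, hence
    it preserves mu and is mixing.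

    To obtain this from the characteristic functional, note that every jump has
    norm at most max lam, so that kappa = 1 on the jumps and the compensator
    cancels the drift: the exponent of f is the series of the
    exp (i lam_k f(e_k)) - 1 ([exponent_Re], [exponent_Im]). Adding t N_i to an f
    that vanishes at e_i therefore adds exp (i t) - 1 to the exponent
    ([exponent_add_jump_count]). For t = 2 pi this is 0, and N_i is almost surely
    an integer ([jump_count_int_full]). The indicator of a residue class of an
    integer modulo M is an average of M characters, so the mu-measure of the set
    where finitely many N_i lie in given classes is a product of finite Fourier
    sums that do not depend on i ([residue_set_mass]). Letting M grow along the
    powers of 2 gives the independence and the common law of the N_i
    ([cylinder_mass]) without any inversion theorem.

    On the set of full measure where all N_n are integers, the truncations of a
    point take countably many values. Hence every ball, and then every Borel set,
    agrees there with a set of the sigma-algebra of the cylinders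
    ([borel_cylinder]). Invariance holds on cylinders, and extends by Dynkin's
    theorem. For mixing, the two sides are equal on two cylinders as soon as n
    exceeds the indices of the first one; the convergence extends because all the
    contents involved are dominated by mu ([dominated_content_cvg]).

    For the codifference, the exponent is continuous, hence it is the continuous
    logarithm of the characteristic functional, and with a_k = lam_k f(e_k) and
    b_k = lam_k g(e_k) the codifference of f and g is the series of the
    (exp (i a_k) - 1) (exp (- i b_k) - 1) ([codifference_le]). Replacing g by its
    image under the n-th power of the adjoint of T moves b_k to b_(k - n). With
    r = p / 2 in [0, 1], the inequality |exp (i x) - 1| <= 2^(1 - r) |x|^r
    ([normc_cis_sub1_le]) then bounds the codifference by 2^(2 - p) times the
    product of |f|^r, |g|^r and the sum of the (lam_l lam_(l + n))^r, and
    2^(2 - p) <= 2^(4 - p). *)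

(** * Sequence spaces and their duals *)

Lemma nneseries_cvg_series (R : realType) (u : nat -> R) (l : R) :
    (forall k, 0 <= u k) -> (\sum_(0 <= k <oo) (u k)%:E = l%:E)%E ->
  series u @ \oo --> l.
Proof.
move=> u0 ul.
have /cvg_ex[/= a ua] : cvgn (fun n => \sum_(0 <= k < n) (u k)%:E)%E.
  by apply: is_cvg_nneseries => k _ _; rewrite lee_fin.
have la : a = l%:E by rewrite -ul; apply/esym/cvg_lim.
move: ua; rewrite la => /fine_cvgP[_].
by apply: cvg_trans; apply: near_eq_cvg; near=> n; rewrite /= sumEFin.
Unshelve. all: by end_near. Qed.

Section ellp_theory.
Context (R : realType) (p : R) (p1 : 1 <= p).
Local Notation E := (ellp p1).
Local Notation e_ := (ellp_basis p1).
Implicit Types x y : E.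

Lemma ellpB x y k : (x - y) k = x k - y k. Proof. by []. Qed.

Lemma ellpZ a x k : (a *: x) k = a * x k. Proof. by []. Qed.

Lemma ellp_basisE n k : e_ n k = (k == n)%:R. Proof. by []. Qed.

Lemma ellp_sumE (I : Type) (r : seq I) (P : pred I) (F : I -> E) k :
  (\sum_(i <- r | P i) F i) k = \sum_(i <- r | P i) F i k.
Proof. by elim/big_rec2 : _ => // i a b _ <-. Qed.

Lemma ellp_exponent_gt0 : 0 < p. Proof. exact: lt_le_trans p1. Qed.

(** The p-th power of the norm turns each comparison of norms below into a
    comparison of real series. *)
Lemma ellp_normE x :
  (`|x| `^ p)%:E = (\sum_(0 <= k <oo) (`|x k| `^ p)%:E)%E.
Proof.
have p0 := ellp_exponent_gt0.
rewrite -poweR_EFin [X in poweR X _](finite_norm_fine (x : LfunType _ _)).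
rewrite Lnorm_counting// -poweRrM mulVf ?gt_eqF//.
by rewrite poweRe1// nneseries_ge0// => k _ _; exact: poweR_ge0.
Qed.

Lemma ellp_norm_cvg x :
  series (fun k => `|x k| `^ p) @ \oo --> `|x| `^ p.
Proof.
apply: nneseries_cvg_series; first by move=> k; exact: powR_ge0.
by rewrite -ellp_normE.
Qed.
Arguments ellp_norm_cvg : clear implicits.

Lemma ellp_norm_le x y : (forall k, `|x k| <= `|y k|) -> `|x| <= `|y|.
Proof.
move=> xy; rewrite leNgt; apply/negP => /(gt0_ltr_powR ellp_exponent_gt0).
rewrite !nnegrE !normr_ge0 => /(_ isT isT); apply/negP; rewrite -leNgt.
apply: (ler_cvg_to (ellp_norm_cvg x) (ellp_norm_cvg y)).
apply: nearW => n; apply: ler_sum => k _.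
by rewrite ge0_ler_powR ?nnegrE// ltW// ellp_exponent_gt0.
Qed.

Lemma ellp_coord_le x k : `|x k| <= `|x|.
Proof.
rewrite leNgt; apply/negP => /(gt0_ltr_powR ellp_exponent_gt0).
rewrite !nnegrE !normr_ge0 => /(_ isT isT); apply/negP; rewrite -leNgt.
apply: (cvgr_to_ge (ellp_norm_cvg x)); near=> n.
rewrite /series/= (bigD1_seq k) ?iota_uniq//=.
  by rewrite lerDl sumr_ge0// => i _; exact: powR_ge0.
by rewrite mem_index_iota/=; near: n; exact: nbhs_infty_gt.
Unshelve. all: by end_near. Qed.

Lemma ellp_basis_norm n : `|e_ n| <= 1.
Proof.
rewrite leNgt; apply/negP => /(gt0_ltr_powR ellp_exponent_gt0).
rewrite !nnegrE !normr_ge0 ler01 => /(_ isT isT); apply/negP.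
rewrite -leNgt powR1.
apply: (cvgr_to_le (ellp_norm_cvg _)); apply: nearW => m.
rewrite /series/= (@le_trans _ _ (\sum_(0 <= k < m) (k == n)%:R))//.
  apply: ler_sum => k _; case: eqP => _; rewrite ?normr1 ?powR1// normr0.
  by rewrite powR0// gt_eqF// ellp_exponent_gt0.
rewrite big_mkord -natr_sum -[leRHS]/1%:R ler_nat.
have [nm|mn] := ltnP n m.
  rewrite (bigD1 (Ordinal nm))//= eqxx big1 ?addn0// => i /negPf.
  by rewrite -val_eqE /= => ->.
rewrite big1// => i _; case: eqP => // im.
by have := ltn_ord i; rewrite im ltnNge mn.
Qed.

Definition trunc N x : E := \sum_(i < N) x i *: e_ i.

Lemma truncE N x k : trunc N x k = if (k < N)%N then x k else 0.
Proof.
rewrite /trunc ellp_sumE.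
under eq_bigr do rewrite ellpZ ellp_basisE.
case: ifPn => [kN|].
  rewrite (bigD1 (Ordinal kN))//= eqxx mulr1 big1 ?addr0// => i.
  by rewrite -val_eqE/= eq_sym => /negPf ->; rewrite mulr0.
rewrite -leqNgt => Nk; rewrite big1// => i _.
by rewrite gtn_eqF ?mulr0// (leq_trans (ltn_ord i)).
Qed.

Lemma truncB N x y : trunc N (x - y) = trunc N x - trunc N y.
Proof.
by rewrite /trunc -sumrB; apply: eq_bigr => i _; rewrite ellpB scalerBl.
Qed.

Lemma trunc_norm_le N x : `|trunc N x| <= `|x|.
Proof.
by apply: ellp_norm_le => k; rewrite truncE; case: ifP; rewrite ?normr0.
Qed.

(** The p-th power of the norm of the tail is the tail of a convergent series. *)
Lemma trunc_cvg x : trunc N x @[N --> \oo] --> x.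
Proof.
set u := fun k : nat => `|x k| `^ p.
have tail N : `|x - trunc N x| `^ p = `|x| `^ p - series u N.
  have uE : (fun k : nat => `|(x - trunc N x) k| `^ p) =
            (fun k => if (k < N)%N then 0 else u k).
    apply/funext => k; rewrite ellpB truncE; case: ifP => _; rewrite ?subr0//.
    by rewrite subrr normr0 powR0// gt_eqF// ellp_exponent_gt0.
  apply: (cvg_unique _ (ellp_norm_cvg _)) => //; rewrite uE.
  apply: (@cvg_trans _ ((series u n - series u N) @[n --> \oo])); last first.
    by apply: cvgB; [exact: ellp_norm_cvg|exact: cvg_cst].
  apply: near_eq_cvg; near=> n.
  have Nn : (N <= n)%N by near: n; exact: nbhs_infty_ge.
  rewrite sub_series_geq// /series [RHS](big_cat_nat (leq0n N) Nn)//=.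
  rewrite [X in _ = X + _]big1_seq ?add0r => [|k].
    by apply: eq_big_nat => k /andP[Nk _]; rewrite ltnNge Nk.
  by rewrite mem_index_iota /= => ->.
apply/cvgrPdist_lt => e e0.
have /cvgrPdist_lt/(_ (e `^ p)) := ellp_norm_cvg x.
rewrite powR_gt0// => /(_ isT); apply: filterS => N.
rewrite -tail ger0_norm ?powR_ge0// => xe; rewrite ltNge; apply/negP => ex.
move: xe; apply/negP; rewrite -leNgt ge0_ler_powR// ?nnegrE// ltW//.
exact: ellp_exponent_gt0.
Unshelve. all: by end_near. Qed.

End ellp_theory.
Arguments trunc_cvg {R p p1} x.

Section dual_theory.
Context (R : realType) (V : normedModType R).
Implicit Types f g : dual V.

Lemma dual_continuous f : continuous f.
Proof. by have /set_mem[] := dual_funP f. Qed.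

Lemma dualD f g x : (f + g) x = f x + g x. Proof. by []. Qed.

Lemma dualB f g x : (f - g) x = f x - g x. Proof. by []. Qed.

Lemma dualN f x : (- f) x = - f x. Proof. by []. Qed.

Lemma dualZ a f x : (a *: f) x = a * f x. Proof. by []. Qed.

Lemma dual_le_norm f x : `|f x| <= `|f| * `|x|.
Proof.
have bnd : has_ubound [set `|f y| | y in [set y : V | `|y| <= 1]].
  have /linear_bounded_continuous/linear_boundedP := @dual_continuous f.
  case/pinfty_ex_gt0 => M M0 fM; exists M => _ [y /= y1 <-].
  by rewrite (le_trans (fM y))// ler_piMr// ltW.
have [->|x0] := eqVneq x 0; first by rewrite linear0 !normr0 mulr0.
rewrite -ler_pdivrMr ?normr_gt0//.
apply: (@le_trans _ _ `|f (`|x|^-1 *: x)|).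
  by rewrite linearZ/= normrM normfV normr_id mulrC.
apply: ub_le_sup => //; exists (`|x|^-1 *: x) => //=.
by rewrite normrZ normfV normr_id mulVf// normr_eq0.
Qed.

End dual_theory.

Section ellp_dual.
Context (R : realType) (p : R) (p1 : 1 <= p).
Local Notation E := (ellp p1).
Local Notation e_ := (ellp_basis p1).
Implicit Types (f g : dual E) (x : E).

Lemma dual_basis_le f n : `|f (e_ n)| <= `|f|.
Proof.
by rewrite (le_trans (dual_le_norm f _))// ler_piMr// ellp_basis_norm.
Qed.

Lemma dual_series f x : series (fun k => x k * f (e_ k)) @ \oo --> f x.
Proof.
have : f (trunc N x) @[N --> \oo] --> f x.
  by apply: continuous_cvg; [exact: dual_continuous|exact: trunc_cvg].
apply: cvg_trans; apply: near_eq_cvg; apply: nearW => N /=.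
rewrite /trunc linear_sum /= /series/= big_mkord.
by apply: eq_bigr => i _; rewrite linearZ.
Qed.
Arguments dual_series : clear implicits.

(** The linear span of the basis is dense, by convergence of the truncations. *)
Lemma dual_ext f g : (forall n, f (e_ n) = g (e_ n)) -> f =1 g.
Proof.
move=> fg x; apply: (cvg_unique _ (dual_series f x)) => //.
rewrite (_ : (fun k => _) = (fun k => x k * g (e_ k))).
  exact: dual_series.
by apply/funext => k; rewrite fg.
Qed.

Lemma ellp_coord_subproof n : (fun x : E => x n) \in @in_dual R E.
Proof.
apply/mem_set; split; first by move=> a x y.
move=> x; apply/(@cvgrPdist_lt R R^o E (nbhs x) _ (fun y : E => y n) (x n)).
move=> e e0; near=> y.
by rewrite (le_lt_trans (ellp_coord_le (x - y) n)).
Unshelve. all: by end_near. Qed.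

Definition ellp_coord n : dual E := Dual (ellp_coord_subproof n).

Lemma ellp_coordE n x : ellp_coord n x = x n. Proof. by []. Qed.

End ellp_dual.
Arguments dual_series {R p p1} f x.

(** * Convergence of set functions on a generated sigma-algebra *)

Section dynkin_arguments.
Context d (T : measurableType d) (R : realType) (mu : probability T R).

Lemma preserved_on_sigma_algebra (S : T -> T) (G : set (set T)) :
    measurable_fun [set: T] S -> setI_closed G -> G `<=` measurable ->
    (forall A, G A -> mu (S @^-1` A) = mu A) ->
  forall A, <<s G >> A -> mu (S @^-1` A) = mu A.
Proof.
move=> mS GI Gm muG.
have mpre B : measurable B -> measurable (S @^-1` B).
  by move=> mB; rewrite -[X in measurable X]setTI; exact: mS.
rewrite -(setI_closed_g_dynkin_g_sigma_algebra GI) => A GA.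
suff : <<d G >> `<=` [set A | measurable A /\ mu (S @^-1` A) = mu A].
  by move=> /(_ _ GA)[].
apply: smallest_sub; last by move=> B GB; split; [exact: Gm|exact: muG].
split => /= [|B [mB e]|F tF mF].
- by split=> //; rewrite preimage_setT.
- split; first exact: measurableC.
  by rewrite preimage_setC !probability_setC// ?e//; exact: mpre.
- have mF' i : measurable (F i) by have [] := mF i.
  split; first exact: bigcupT_measurable.
  rewrite preimage_bigcup !measure_bigcup//; last 2 first.
  + by move=> i _; exact: mpre.
  + by move=> i j _ _ [z [zi zj]]; apply: tF => //; exists (S z).
  by apply: eq_eseriesr => i _; have [] := mF i.
Qed.

(** Finite additivity suffices: together with the bound by mu it yields countable
    additivity. *)
Definition dominated_content (nu : set T -> R) :=
  (forall A, measurable A -> 0 <= nu A <= fine (mu A)) /\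
  (forall A B, measurable A -> measurable B -> A `&` B = set0 ->
    nu (A `|` B) = nu A + nu B).

Lemma dominated_content_mu : dominated_content (fine \o mu).
Proof.
split=> [A mA|A B mA mB AB] /=; first by rewrite fine_ge0//= lexx.
by rewrite measureU// fineD// fin_num_measure.
Qed.

Lemma dominated_content0 nu : dominated_content nu -> nu set0 = 0.
Proof.
by case=> /(_ set0 measurable0); rewrite measure0/= -eq_le => /eqP.
Qed.

(** The remainder of a disjoint union is bounded by that of mu, hence uniformly
    over all dominated contents. *)
Lemma dominated_content_tail nu (F : nat -> set T) : dominated_content nu ->
    (forall k, measurable (F k)) -> trivIset setT F -> forall N,
  0 <= nu (\bigcup_k F k) - \sum_(k < N) nu (F k) <=
  fine (mu (\bigcup_k F k)) - \sum_(k < N) fine (mu (F k)).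
Proof.
move=> hnu mF tF N.
have mB n : measurable (\big[setU/set0]_(k < n) F k).
  exact: bigsetU_measurable.
have mU : measurable (\bigcup_k F k) by exact: bigcupT_measurable.
have sumE m : dominated_content m ->
    m (\bigcup_k F k) - \sum_(k < N) m (F k) =
    m ((\bigcup_k F k) `\` \big[setU/set0]_(k < N) F k).
  move=> hm; case: (hm) => _ mD.
  have -> : \sum_(k < N) m (F k) = m (\big[setU/set0]_(k < N) F k).
    elim: N => [|n IH]; first by rewrite !big_ord0 dominated_content0.
    rewrite !big_ord_recr/= IH mD//; first exact: mB.
    rewrite -bigcup_mkord -subset0 => z [[k /= kn Fk] Fn].
    have kE : k = n by apply: tF => //; exists z.
    by rewrite kE ltnn in kn.
  rewrite -[X in m X - _](@setDUK _ (\big[setU/set0]_(k < N) F k)); last first.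
    by rewrite -bigcup_mkord => z [k _ Fkz]; exists k.
  rewrite mD ?setDIK//; first by rewrite addrAC subrr add0r.
  exact: measurableD.
rewrite (sumE _ hnu) (sumE _ dominated_content_mu); apply: hnu.1.
exact: measurableD.
Qed.

(** The sets on which the contents converge form a Dynkin system; for countable
    disjoint unions, the tails are uniformly small because mu controls them all. *)
Lemma dominated_content_cvg (nu_ : nat -> set T -> R) (nu : set T -> R)
    (G : set (set T)) : setI_closed G -> G `<=` measurable ->
    (forall n, dominated_content (nu_ n)) -> dominated_content nu ->
    nu_ n setT @[n --> \oo] --> nu setT ->
    (forall A, G A -> nu_ n A @[n --> \oo] --> nu A) ->
  forall A, <<s G >> A -> nu_ n A @[n --> \oo] --> nu A.
Proof.
move=> GI Gm dnu_ dnu cvgT cvgG.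
rewrite -(setI_closed_g_dynkin_g_sigma_algebra GI) => A GA.
suff : <<d G >> `<=`
    [set A | measurable A /\ nu_ n A @[n --> \oo] --> nu A].
  by move=> /(_ _ GA)[].
apply: smallest_sub; last by move=> B GB; split; [exact: Gm|exact: cvgG].
split => /= [//|B [mB cB]|F tF mcF].
  have CE m : dominated_content m -> m (~` B) = m setT - m B.
    move=> -[_ mD]; rewrite -(setvU B) mD ?setICl//; last exact: measurableC.
    by rewrite addrK.
  split; first exact: measurableC.
  rewrite (CE _ dnu) (_ : (fun n => _) = (fun n => nu_ n setT - nu_ n B)).
    exact: cvgB.
  by apply/funext => n; rewrite CE.
have mF k : measurable (F k) by have [] := mcF k.
have cF k : nu_ n (F k) @[n --> \oo] --> nu (F k) by have [] := mcF k.
split; first exact: bigcupT_measurable.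
have mU : measurable (\bigcup_k F k) by exact: bigcupT_measurable.
have sF : \sum_(k < N) fine (mu (F k)) @[N --> \oo] --> fine (mu (\bigcup_k F k)).
  have /fine_cvgP[_] : (\sum_(0 <= k < N) mu (F k))%E @[N --> \oo] -->
      (fine (mu (\bigcup_k F k)))%:E.
    by rewrite fineK ?fin_num_measure//; exact: measure_sigma_additive.
  apply: cvg_trans; apply: near_eq_cvg; apply: nearW => N /=.
  rewrite big_mkord (eq_bigr (fun k : 'I_N => (fine (mu (F k)))%:E)) ?sumEFin// => k _.
  by rewrite fineK// fin_num_measure.
apply/cvgrPdist_lt => e e0.
have e2 : 0 < e / 2 by rewrite divr_gt0.
have /cvgrPdist_lt/(_ _ e2) := sF.
(* This N makes the tail of mu, which bounds the tails of all the contents,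
   smaller than e / 2; the first N terms converge separately. *)
move=> [N _ /(_ N (leqnn N))]/=.
set t := _ - _ => tN.
have cS : \sum_(k < N) nu_ n (F k) @[n --> \oo] --> \sum_(k < N) nu (F k).
  by apply: cvg_big => //; exact: add_continuous.
have /cvgrPdist_lt/(_ _ e2) := cS.
apply: filterS => n /ltr_normlP[h1 h2].
have /andP[a1 a2] := dominated_content_tail (dnu_ n) mF tF N.
have /andP[b1 b2] := dominated_content_tail dnu mF tF N.
move: tN => /ltr_normlP[_ tN].
apply/ltr_normlP; rewrite -/t in a2 b2; split; lra.
Qed.

End dynkin_arguments.

(** * Bounds and identities for the complex exponential *)

Section trigonometric_bounds.
Context (R : realType).
Implicit Types (x y : R) (f : R -> R).

(** Mean value inequality on the ball of radius |x| + |y|; for a derivative of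
    size at most |c| at c, it gives the quadratic estimates [cos_dist] and
    [sin_sub_dist]. *)
Lemma derive_bound_dist f (df : R -> R) (B : R) x y :
    (forall c : R, is_derive c 1 f (df c)) ->
    (forall c, `|c| <= `|x| + `|y| -> `|df c| <= B) ->
  `|f x - f y| <= B * `|x - y|.
Proof.
move=> fdf; wlog xy : x y / y <= x => [H|] dfB.
  have [yx|xy] := leP y x; first exact: H.
  by rewrite distrC (distrC x) H ?(ltW xy)// => c; rewrite addrC; exact: dfB.
have [|c cyx fE] := @MVT_segment R f df y x xy.
- apply: continuous_subspaceT => c.
  by apply/differentiable_continuous/derivable1_diffP; have [] := fdf c.
rewrite fE normrM ler_wpM2r// dfB//.
move: cyx; rewrite in_itv/= => /andP[yc cx].
have := ler_norm x; have := ler_norm (- y); rewrite normrN.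
have := normr_ge0 x; have := normr_ge0 y.
by rewrite ler_norml => *; apply/andP; split; lra.
Qed.

Lemma ler_norm_sin x : `|sin x| <= `|x|.
Proof.
have := @derive_bound_dist sin cos 1 x 0 (fun c => is_derive_sin c).
by rewrite sin0 !subr0 mul1r; apply => c _; exact: cos_max.
Qed.

Lemma cos_half x : cos x = 1 - 2 * sin (x / 2) ^+ 2.
Proof.
rewrite [in LHS](splitr x) cosD -!expr2 cos2sin2; ring.
Qed.

Lemma ler_norm_1subcos x : `|cos x - 1| <= `|x|.
Proof.
rewrite cos_half addrAC subrr add0r normrN normrM normrX.
rewrite [X in X * _]ger0_norm// [leRHS](_ : _ = 2 * `|x / 2|).
  rewrite ler_wpM2l// expr2 (le_trans _ (ler_norm_sin _))//.
  by rewrite ler_piMr// sin_max.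
by rewrite normrM (_ : `|2^-1| = 2^-1); [field|rewrite ger0_norm].
Qed.

(** The estimates of this form, against the square summability of lam, make the
    compensated series converge and depend continuously on the functional. *)
Lemma cos_dist x y : `|cos x - cos y| <= (`|x| + `|y|) * `|x - y|.
Proof.
apply: (derive_bound_dist (fun c => is_derive_cos c)) => c.
by rewrite normrN; apply: le_trans; exact: ler_norm_sin.
Qed.

Lemma sin_sub_dist x y :
  `|(sin x - x) - (sin y - y)| <= (`|x| + `|y|) * `|x - y|.
Proof.
apply: (@derive_bound_dist (sin \- id) (cos \- cst 1)) => c.
by rewrite /=; apply: le_trans; exact: ler_norm_1subcos.
Qed.

(** Remove the integer part of x: what is left lies in [0, 1[, where sin (pi t)
    vanishes only at 0. *)
Lemma cos_2pi_eq1 x : cos (2 * pi * x) = 1 -> x \is a Num.int.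
Proof.
move=> H.
have s0 : sin (pi * x) = 0.
  apply/eqP; rewrite -sqrf_eq0; have := cos_half (2 * pi * x); rewrite H.
  by rewrite (_ : 2 * pi * x / 2 = pi * x); [move=> ?; apply/eqP; lra|field].
pose t := x - (Num.floor x)%:~R.
have [t0 t1] : 0 <= t /\ t < 1.
  by have /andP[] := floor_itv x; rewrite intrD /t => *; split; lra.
have st : sin (pi * t) = 0.
  have alt (n : nat) u : sin u = 0 -> sin (u + pi * n%:R) = 0.
    by move=> u0; rewrite mulr_natr alternatingn ?u0 ?mulr0//; exact: sinDpi.
  have alt' (n : nat) u : sin u = 0 -> sin (u - pi * n%:R) = 0.
    move=> u0; apply/eqP; rewrite -oppr_eq0 -sinN opprB addrC alt//.
    by rewrite sinN u0 oppr0.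
  rewrite /t mulrBr; case: (Num.floor x) => n; first by rewrite alt'.
  by rewrite NegzE mulrNz mulrN opprK alt.
have [t00|tn0] := eqVneq t 0.
  by rewrite intrEfloor eq_sym -subr_eq0 -/t t00.
suff : 0 < sin (pi * t) by rewrite st ltxx.
apply: sin_gt0_pi; apply/andP; split; last by rewrite gtr_pMr ?pi_gt0.
by rewrite mulr_gt0 ?pi_gt0// lt0r tn0.
Qed.

Definition cis x : R[i] := (cos x +i* sin x)%C.

Lemma cis0 : cis 0 = 1. Proof. by rewrite /cis cos0 sin0. Qed.

Lemma cisD x y : cis (x + y) = cis x * cis y.
Proof.
rewrite /cis cosD sinD; apply/eqP; rewrite eq_complex/= eqxx/=.
by rewrite addrC.
Qed.

Lemma cexp0 : cexp (0 : R[i]) = 1.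
Proof. by rewrite /cexp/= expR0 cos0 sin0 mulr1 mulr0. Qed.

Lemma cexpD (z w : R[i]) : cexp (z + w) = cexp z * cexp w.
Proof.
have E (u : R[i]) : cexp u = (expR (complex.Re u))%:C%C * cis (complex.Im u).
  apply/eqP.
  by rewrite /cexp /cis eq_complex/= !mul0r subr0 addr0 !eqxx.
by rewrite !E raddfD/= raddfD/= expRD cisD rmorphM mulrACA.
Qed.

(** De Moivre's formula. *)
Lemma cis_mulrn (n : nat) x : cis (n%:R * x) = cis x ^+ n.
Proof.
elim: n => [|n IH]; first by rewrite mul0r expr0 cis0.
by rewrite exprS -IH -cisD -nat1r mulrDl mul1r.
Qed.

Lemma cis_2pi_int x : x \is a Num.int -> cis (2 * pi * x) = 1.
Proof.
have nat1 (n : nat) : cis (2 * pi * n%:R) = 1.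
  by rewrite mulrC cis_mulrn mulr_natl /cis cos2pi sin2pi expr1n.
move=> /intrP[[n|n] ->]; first exact: nat1.
rewrite NegzE mulrNz mulrN.
by rewrite -[LHS]mul1r -[X in X * _](nat1 n.+1) -cisD addrN cis0.
Qed.

Lemma normc_cis_sub1 x :
  ComplexField.Normc.normc (cis x - 1) = 2 * `|sin (x / 2)|.
Proof.
rewrite /= (_ : _ + _ = (2 * sin (x / 2)) ^+ 2).
  by rewrite sqrtr_sqr normrM ger0_norm.
rewrite oppr0 addr0 sqrrB1 (_ : _ + _ = 2 * (1 - cos x)); last first.
  by have := cos2Dsin2 x; lra.
by rewrite cos_half; ring.
Qed.

(** Interpolates between |exp (i x) - 1| <= 2 (r = 0) and |exp (i x) - 1| <= |x|
    (r = 1): a number s = |sin (x / 2)| in [0, 1] is at most s^r. *)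
Lemma normc_cis_sub1_le (r : R) x : 0 <= r <= 1 ->
  ComplexField.Normc.normc (cis x - 1) <= 2 `^ (1 - r) * `|x| `^ r.
Proof.
move=> /andP[r0 r1]; rewrite normc_cis_sub1; set s := `|_|.
have s1 : s <= 1 by exact: sin_max.
have [->|sn0] := eqVneq s 0; first by rewrite mulr0 mulr_ge0// powR_ge0.
have s0 : 0 < s by rewrite lt0r sn0 normr_ge0.
apply: (@le_trans _ _ (2 * s `^ r)).
  by rewrite ler_pM2l// ger1_powR// s0.
apply: (@le_trans _ _ (2 * (`|x| / 2) `^ r)).
  rewrite ler_pM2l// ge0_ler_powR ?nnegrE// ?divr_ge0//; first exact: ltW.
  by rewrite (le_trans (ler_norm_sin _))// normrM [X in _ * X]ger0_norm.
rewrite powRM// -(@powR_inv1 _ 2)// -powRrM mulN1r.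
by rewrite powRD ?pnatr_eq0 ?implybT// powRr1// mulrCA mulrC -mulrA.
Qed.

(** Orthogonality of characters: averaged over j, the left-hand side detects
    whether the integer M x is divisible by M. *)
Lemma sum_cis_period (M : nat) x : (0 < M)%N -> M%:R * x \is a Num.int ->
  \sum_(j < M) cis (2 * pi * (j%:R * x)) = if x \is a Num.int then M%:R else 0.
Proof.
move=> M0 Mx; under eq_bigr do rewrite mulrCA cis_mulrn.
case: ifPn => [xi|xni].
  rewrite cis_2pi_int//; under eq_bigr do rewrite expr1n.
  by rewrite sumr_const card_ord.
have z1 : cis (2 * pi * x) - 1 != 0.
  apply: contra xni; rewrite subr_eq0 => /eqP z1; apply: cos_2pi_eq1.
  by rewrite -[LHS]/(complex.Re (cis (2 * pi * x))) z1.
(* Geometric sum, whose ratio is not 1 but whose M-th power is 1. *)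
apply: (mulfI z1); rewrite mulr0 -subrX1 -cis_mulrn mulrCA cis_2pi_int// subrr.
by [].
Qed.

End trigonometric_bounds.

(** * Integrals against sums of Dirac masses, Borel sets *)

Lemma bounded_series_cvg (R : realType) (u : nat -> R) (S : R) :
  (forall N, series (fun k => `|u k|) N <= S) -> cvgn (series u).
Proof.
move=> uS; apply: normed_cvg; apply: nondecreasing_is_cvgn.
  by apply: nondecreasing_series => k *; rewrite normr_ge0.
by exists S => _ [N _ <-]; exact: uS.
Qed.

(** Absolute summability of F along the atoms is the integrability of F against
    the sum of the Dirac masses. *)
Lemma Rintegral_series_dirac d (T : measurableType d) (R : realType)
    (a : nat -> T) (F : T -> R) (S : R) : measurable_fun [set: T] F ->
    (forall N, series (fun k => `|F (a k)|) N <= S) ->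
  series (F \o a) @ \oo --> \int[mseries (fun n => \d_(a n)) 0]_z F z.
Proof.
move=> mF FS.
have cF := bounded_series_cvg FS.
have intE (n : nat) (f : T -> \bar R) : measurable_fun [set: T] f ->
    (\int[\d_(a n)]_z f z)%E = f (a n).
  by move=> mf; rewrite integral_dirac// diracT mul1e.
have mEF : measurable_fun [set: T] (EFin \o F) by exact/measurable_EFinP.
have mN : measurable_fun [set: T] ((EFin \o F)^\-)%E by exact: measurable_funeneg.
have mP : measurable_fun [set: T] ((EFin \o F)^\+)%E by exact: measurable_funepos.
have absF : (\sum_(0 <= n <oo) `|F (a n)|%:E < +oo)%E.
  apply: (@le_lt_trans _ _ S%:E); last by rewrite ltry.
  apply: lime_le; first by apply: is_cvg_nneseries => k _ _; rewrite lee_fin.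
  by apply: nearW => N; rewrite sumEFin lee_fin; exact: FS.
rewrite /Rintegral integral_measure_series//.
- under eq_eseriesr do rewrite intE//.
  suff -> : (\sum_(0 <= n <oo) (EFin \o F) (a n) =
      (limn (series (F \o a)))%:E)%E by [].
  apply/cvg_lim => //.
  rewrite (_ : (fun n => _) = EFin \o series (F \o a)).
    by apply/fine_cvgP; split; [exact: nearW|exact: cF].
  by apply/funext => n; rewrite /= -sumEFin.
- move=> n; apply/integrableP; split => //.
  by rewrite intE ?ltry//; exact: measurableT_comp.
- apply: le_lt_trans absF; apply: lee_nneseries => // n _; rewrite intE//.
  rewrite -[leRHS]/((abse \o (EFin \o F)) (a n)) fune_abse gee0_abs//.
  by rewrite leeDr.
- apply: le_lt_trans absF; apply: lee_nneseries => // n _; rewrite intE//.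
  rewrite -[leRHS]/((abse \o (EFin \o F)) (a n)) fune_abse gee0_abs//.
  by rewrite leeDl.
Qed.

Section borel.
Context (R : realType) (V : normedModType R).

Lemma borel_open (A : set V) : open A -> measurable (A : set (borel V)).
Proof. by move=> oA; exact: sub_sigma_algebra. Qed.

Lemma borel_continuous_real (f : V -> R) : continuous f ->
  measurable_fun [set: borel V] (f : borel V -> R).
Proof.
move=> /continuousP cf; apply: (measurability _ (RGenOpens.measurableE R)).
move=> _ [_ [a [b ->]] <-]; rewrite setTI; apply: borel_open.
by apply: cf; exact: interval_open.
Qed.

Lemma borel_continuous (f : V -> V) : continuous f ->
  measurable_fun [set: borel V] (f : borel V -> borel V).
Proof.
move=> /continuousP cf.
apply: (@measurability _ _ (borel V) (borel V) _ _ (@open V)) => //.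
by move=> _ [A oA <-]; rewrite setTI; apply: borel_open; exact: cf.
Qed.

End borel.

(** * Continuous logarithms *)

Lemma continuous_complex_Im (R : realType) :
  continuous (@complex.Im R : R[i]^o -> R).
Proof.
move=> z; apply/(@cvgrPdist_lt R R^o R[i]^o (nbhs z) _ (@complex.Im R)
  (complex.Im z)) => e e0.
have : \forall w \near nbhs (z : R[i]^o), `|z - w| < e%:C%C.
  by apply: cvgr_dist_lt => //; rewrite ltcR.
apply: filterS => w; rewrite normc_def ltcR; apply: le_lt_trans.
rewrite -sqrtr_sqr; case: z w => a b [c d] /=.
by rewrite ler_wsqrtr// lerDr sqr_ge0.
Qed.

Lemma cexp_eq (R : realType) (z w : R[i]) : cexp z = cexp w ->
  complex.Re z = complex.Re w /\
  (complex.Im z - complex.Im w) / (2 * pi) \is a Num.int.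
Proof.
case: z w => a b [c d]; rewrite /cexp /= => -[h1 h2].
have ac : expR a = expR c.
  apply/eqP; rewrite -(@eqrXn2 _ 2)// ?expR_ge0//; apply/eqP.
  rewrite -[LHS]mulr1 -[RHS]mulr1 -[X in _ * X](cos2Dsin2 b).
  rewrite -[in RHS](cos2Dsin2 d) !mulrDr -!exprMn h1 h2.
  by [].
split; first exact: expR_inj.
apply: cos_2pi_eq1.
rewrite mulrC divfK ?mulf_neq0 ?gt_eqF ?pi_gt0//.
have e0 : expR c != 0 by rewrite gt_eqF ?expR_gt0.
rewrite ac in h1 h2; move/(mulfI e0) : h1 => h1; move/(mulfI e0) : h2 => h2.
by rewrite cosB h1 h2 -!expr2 cos2Dsin2.
Qed.

(** The square of a nonzero integer is at least 1: if d 1 were not 0, then d^2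
    would take the value 1 / 2 on the way from 0 to 1. *)
Lemma continuous_int_valued (R : realType) (d : R -> R) : continuous d ->
  d 0 = 0 -> (forall t, d t \is a Num.int) -> d 1 = 0.
Proof.
move=> cd d0 di; apply/eqP/negPn/negP => d1.
have c2 : continuous (fun t => d t * d t).
  by move=> t; apply: continuousM; exact: cd.
have d1ge : 1 <= d 1 ^+ 2 by exact: sqr_intr_ge1.
have [] := @IVT R (fun t => d t * d t) 0 1 (1 / 2) ler01.
- exact: continuous_subspaceT.
- rewrite d0 mul0r -expr2 ge_min le_max; apply/andP.
  by split; apply/orP; [left|right]; lra.
move=> c _; rewrite -expr2 => dc.
have [dc0|dcn0] := eqVneq (d c) 0; first by move: dc; rewrite dc0 expr0n/=; lra.
by have := sqr_intr_ge1 (di c) dcn0; rewrite dc; lra.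
Qed.

(** Along the segment from 0 to f, two logarithms differ by 2 i pi times a
    continuous integer, which vanishes at 0. *)
Lemma continuous_log_unique (R : realType) (V : normedModType R)
    (phi psi1 psi2 : dual V -> R[i]) :
  is_continuous_log phi psi1 -> is_continuous_log phi psi2 -> psi1 = psi2.
Proof.
move=> [c1 z1 e1] [c2 z2 e2]; apply/funext => f.
(* The winding number between the two logarithms along the ray of f. *)
pose d t := (complex.Im (psi1 (t *: f)) - complex.Im (psi2 (t *: f))) / (2 * pi).
have ce t : cexp (psi1 (t *: f)) = cexp (psi2 (t *: f)) by rewrite e1 e2.
have cIm (psi : dual V -> R[i]) : continuous (psi : dual V -> R[i]^o) ->
    continuous (fun t : R => complex.Im (psi (t *: f))).
  move=> cpsi t.
  apply: (@continuous_comp _ _ _ (fun t : R => psi (t *: f) : R[i]^o)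
    (@complex.Im R)); last exact: continuous_complex_Im.
  apply: (@continuous_comp _ _ _ (fun t : R => t *: f)
    (psi : dual V -> R[i]^o)); last exact: cpsi.
  exact: scalel_continuous.
have cd : continuous d.
  move=> t; apply: cvgMr_tmp; apply: cvgB; exact: cIm.
have d1 : d 1 = 0.
  apply: continuous_int_valued => //.
    by rewrite /d !scale0r z1 z2 subrr mul0r.
  by move=> t; have [] := cexp_eq (ce t).
have [re _] := cexp_eq (ce 1).
move: re d1; rewrite /d !scale1r => re /eqP.
rewrite mulf_eq0 invr_eq0 mulf_eq0 pnatr_eq0 (gt_eqF (pi_gt0 _)) !orbF.
rewrite subr_eq0 => /eqP.
by case: (psi1 f) (psi2 f) re => a b [c d'] /= -> ->.
Qed.

(** The norm of the sum of a series is bounded by the sum of the norms, for a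
    series known only through its real and imaginary parts. *)
Lemma series_normc_le (R : realType) (u : nat -> R[i]) (z : R[i]) (B : \bar R) :
    series (@complex.Re R \o u) @ \oo --> complex.Re z ->
    series (@complex.Im R \o u) @ \oo --> complex.Im z ->
    (forall N, (\sum_(k < N) ComplexField.Normc.normc (u k))%:E <= B)%E ->
  ((ComplexField.Normc.normc z)%:E <= B)%E.
Proof.
move=> cre cim; case: B => [B| |] uB; [|by rewrite leey|by have := uB 0%N].
pose q (x y : R) := Num.sqrt (x * x + y * y).
have normcE w : ComplexField.Normc.normc w = q (complex.Re w) (complex.Im w).
  by case: w => a b; rewrite /q -!expr2.
rewrite lee_fin normcE.
have cq : q (series (@complex.Re R \o u) N) (series (@complex.Im R \o u) N)
    @[N --> \oo] --> q (complex.Re z) (complex.Im z).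
  rewrite /q; apply: (continuous_cvg _ (@sqrt_continuous R _)).
  by apply: cvgD; apply: cvgM.
apply: (cvgr_to_le cq); apply: nearW => N.
have := uB N; rewrite lee_fin; apply: le_trans.
rewrite /series/= -!raddf_sum -normcE big_mkord.
elim/big_ind2 : _ => [|x1 y1 x2 y2 h1 h2|//].
  by rewrite ComplexField.Normc.normc0.
by rewrite (le_trans (le_normcD _ _))// lerD.
Qed.

(** * Bounded random variables *)

Section bounded_integrals.
Context d (T : measurableType d) (R : realType) (P : probability T R).
Implicit Types (F : T -> R) (D : set T).

Definition bounded_measurable F :=
  measurable_fun [set: T] F /\ exists c, forall z, `|F z| <= c.

Lemma bounded_measurable_integrable F D : measurable D ->
  bounded_measurable F -> P.-integrable D (EFin \o F).
Proof.
move=> mD [mF [c Fc]]; apply: measurable_bounded_integrable => //.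
- by rewrite (le_lt_trans (probability_le1 P mD))// ltry.
- exact: measurable_funS mF.
- exists c; split; first exact: num_real.
  by move=> x cx z _ /=; rewrite (le_trans (Fc z))// ltW.
Qed.

Lemma bounded_measurableZ (c : R) F :
  bounded_measurable F -> bounded_measurable (fun z => c * F z).
Proof.
move=> [mF [b Fb]]; split; first exact: measurable_funM.
by exists (`|c| * b) => z; rewrite normrM ler_wpM2l.
Qed.

Lemma bounded_measurable_sum (n : nat) (F : nat -> T -> R) :
    (forall j, bounded_measurable (F j)) ->
  bounded_measurable (fun z => \sum_(j < n) F j z).
Proof.
move=> bF; elim: n => [|n [mS [c Sc]]].
  rewrite (_ : (fun z => _) = cst 0); last first.
    by apply/funext => z; rewrite big_ord0.
  by split => //; exists 0 => z; rewrite normr0.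
have [mF [c' Fc]] := bF n.
rewrite (_ : (fun z => _) = (fun z => \sum_(j < n) F j z + F n z)); last first.
  by apply/funext => z; rewrite big_ord_recr.
split; first exact: measurable_funD.
by exists (c + c') => z; rewrite (le_trans (ler_normD _ _))// lerD.
Qed.

Lemma Rintegral_sum (n : nat) (F : nat -> T -> R) D : measurable D ->
    (forall j, bounded_measurable (F j)) ->
  \int[P]_(z in D) (\sum_(j < n) F j z) = \sum_(j < n) \int[P]_(z in D) F j z.
Proof.
move=> mD bF; elim: n => [|n IH].
  by under eq_Rintegral do rewrite big_ord0; rewrite Rintegral_cst// mul0r big_ord0.
under eq_Rintegral do rewrite big_ord_recr/=.
rewrite RintegralD//; last 2 first.
- apply: (@bounded_measurable_integrable (fun z => \sum_(j < n) F j z)) => //.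
  exact: bounded_measurable_sum.
- exact: bounded_measurable_integrable.
by rewrite IH big_ord_recr.
Qed.

Lemma Rintegral_full_set F D L : measurable D -> measurable L ->
    P (~` L) = 0%E -> bounded_measurable F ->
  \int[P]_(z in D `&` L) F z = \int[P]_(z in D) F z.
Proof.
move=> mD mL L0 bF; rewrite /Rintegral.
rewrite [in RHS](@negligible_integral _ _ _ _ _ (~` L))//.
- by rewrite setDE setCK.
- exact: measurableC.
- exact: bounded_measurable_integrable.
Qed.

(** The condition is a closed one: cos (2 pi F) = 1. *)
Lemma measurable_int_valued F : measurable_fun [set: T] F ->
  measurable [set z | F z \is a Num.int].
Proof.
move=> mF.
rewrite (_ : [set z | _] = (fun z => cos (2 * pi * F z)) @^-1` [set 1]).
  have mc : measurable_fun [set: T] (fun z => cos (2 * pi * F z)).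
    apply: (measurableT_comp (f := cos)).
      by apply: continuous_measurable_fun; exact: continuous_cos.
    exact: measurable_funM.
  rewrite -[X in measurable X]setTI.
  exact: (mc measurableT _ (measurable_set1 1)).
apply/seteqP; split=> z /=; last exact: cos_2pi_eq1.
by move=> /cis_2pi_int; rewrite /cis => -[].
Qed.

(** The function 1 - cos (2 pi F) is nonnegative with integral 0, so that it
    vanishes almost everywhere. *)
Lemma int_valued_full F : measurable_fun [set: T] F ->
    \int[P]_z cos (2 * pi * F z) = 1 ->
  P (~` [set z | F z \is a Num.int]) = 0%E.
Proof.
move=> mF F1.
have mc : measurable_fun [set: T] (fun z => cos (2 * pi * F z)).
  apply: (measurableT_comp (f := cos)).
    by apply: continuous_measurable_fun; exact: continuous_cos.
  by apply: measurable_funM.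
have bc : bounded_measurable (fun z => cos (2 * pi * F z)).
  by split => //; exists 1 => z; exact: cos_max.
have b1 : bounded_measurable (fun=> 1 : R).
  by split => //; exists 1 => z; rewrite normr1.
have i0 : \int[P]_z (1 - cos (2 * pi * F z)) = 0.
  rewrite RintegralB//; last 2 first.
  - exact: (bounded_measurable_integrable measurableT b1).
  - exact: bounded_measurable_integrable.
  by rewrite F1 Rintegral_cst// mul1r [X in fine X]probability_setT subrr.
have mG : measurable_fun [set: T] (fun z => (1 - cos (2 * pi * F z))%:E).
  by apply/measurable_EFinP; apply: measurable_funB.
have : ae_eq P setT (fun z => (1 - cos (2 * pi * F z))%:E) (cst 0%E).
  apply/(ae_eq_integral_abs P measurableT mG).
  rewrite (eq_integral (fun z => (1 - cos (2 * pi * F z))%:E)); last first.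
    by move=> z _; rewrite gee0_abs// lee_fin subr_ge0 cos_le1.
  rewrite -[LHS]fineK.
    by congr EFin.
  apply: integrable_fin_num => //.
  apply: (@bounded_measurable_integrable (fun z => 1 - cos (2 * pi * F z))) => //.
  split; first exact: measurable_funB.
  exists 2 => z; rewrite (le_trans (ler_normB _ _))// normr1.
  rewrite -[2]/(1 + 1 : R) lerD2l.
  exact: cos_max.
move=> [N [mN N0 sN]]; apply: (@subset_measure0 _ _ _ P _ N) => //.
  by apply: measurableC; exact: measurable_int_valued.
move=> z /= zi; apply: sN => /= /(_ Logic.I) [c0]; apply: zi.
by apply: cos_2pi_eq1; apply/eqP; rewrite eq_sym -subr_eq0 c0.
Qed.

End bounded_integrals.

(** * The characteristic exponent *)

Section characteristic_exponent.
Context (R : realType) (p : R) (p1 : 1 <= p) (p2 : p < 2).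
Context (lam : nat -> R) (lam_gt0 : forall n, 0 < lam n).
Context (lam_ellp : lam \in Lfun (nat_counting R) p%:E).
Local Notation E := (ellp p1).
Local Notation e_ := (ellp_basis p1).
Implicit Types f g : dual E.

(** The point of l^p with coordinates lam n, which is the drift of mu. *)
Definition jump_total : E := Lfun_Sub _ lam_ellp.

Lemma jump_totalE n : jump_total n = lam n. Proof. by []. Qed.

Lemma jump_total_lim : limn (series (fun n => lam n *: e_ n)) = jump_total.
Proof.
apply/cvg_lim; first exact: norm_hausdorff.
have := trunc_cvg jump_total; apply: cvg_trans.
by apply: near_eq_cvg; apply: nearW => N; rewrite /trunc /series/= big_mkord.
Qed.

(** The condition p < 2 enters here: lam^2 = lam^(2 - p) lam^p, where the first
    factor is bounded and the second is summable. *)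
Lemma lam_square_sum N : series (fun k => lam k ^+ 2) N <= `|jump_total| ^+ 2.
Proof.
have p0 := ellp_exponent_gt0 p1.
have x0 : 0 < `|jump_total|.
  apply: lt_le_trans (ellp_coord_le jump_total 0).
  by rewrite normr_gt0 gt_eqF// jump_totalE.
have sqE (y : R) : 0 < y -> y ^+ 2 = y `^ (2 - p) * y `^ p.
  move=> y0; rewrite -powRD; last by rewrite (gt_eqF y0) implybT.
  by rewrite subrK powR_mulrn// ltW.
rewrite sqE//.
apply: (@le_trans _ _ (`|jump_total| `^ (2 - p) *
    series (fun k => `|jump_total k| `^ p) N)).
  rewrite /series/= mulr_sumr; apply: ler_sum => k _.
  have := ellp_coord_le jump_total k; rewrite jump_totalE gtr0_norm// => lx.
  rewrite sqE// ler_wpM2r ?powR_ge0// ge0_ler_powR ?nnegrE//.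
  - by rewrite subr_ge0 ltW.
  - exact: ltW.
rewrite ler_wpM2l ?powR_ge0//.
have cn := @ellp_norm_cvg _ _ _ jump_total.
rewrite -(cvg_lim _ cn)//; apply: nondecreasing_cvgn_le; last exact: cvgP cn.
by apply: nondecreasing_series => k *; rewrite powR_ge0.
Qed.

Definition exponent f : R[i] :=
  levy_khintchine (limn (series (fun n => lam n *: e_ n)))
    \1_[set z : E | `|z| <= sup (range lam)]
    (sum_dirac (fun n => lam n *: e_ n)) f.

(** The truncation function kappa equals 1 at every jump. *)
Lemma jump_norm_le n : `|lam n *: e_ n| <= sup (range lam).
Proof.
rewrite normrZ gtr0_norm// (@le_trans _ _ (lam n))//.
  by rewrite ler_piMr// ?ellp_basis_norm// ltW.
apply: ub_le_sup; last by exists n.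
exists `|jump_total| => _ [k _ <-].
by rewrite (le_trans _ (ellp_coord_le _ k))// ler_norm.
Qed.

Lemma jump_dual f n : f (lam n *: e_ n) = lam n * f (e_ n).
Proof. by rewrite linearZ. Qed.

Lemma jump_square_sum (F : R -> R) f g N :
    (forall x y, `|F x - F y| <= (`|x| + `|y|) * `|x - y|) ->
  series (fun k => `|F (lam k * f (e_ k)) - F (lam k * g (e_ k))|) N <=
  `|jump_total| ^+ 2 * ((`|f| + `|g|) * `|f - g|).
Proof.
move=> FP; apply: (@le_trans _ _
    (series (fun k => lam k ^+ 2) N * ((`|f| + `|g|) * `|f - g|))).
  rewrite /series/= mulr_suml; apply: ler_sum => k _.
  apply: (le_trans (FP _ _)).
  rewrite -mulrBr !normrM (gtr0_norm (lam_gt0 k)) -mulrDr mulrACA -expr2.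
  rewrite ler_wpM2l ?sqr_ge0// ler_pM//.
  - by rewrite lerD// dual_basis_le.
  - by rewrite -dualB dual_basis_le.
by rewrite ler_wpM2r ?lam_square_sum// mulr_ge0// addr_ge0.
Qed.

Lemma ball_indic_measurable (c : R) : measurable_fun [set: borel E]
  (\1_[set z : E | `|z| <= c] : borel E -> R).
Proof.
apply: measurable_indic.
rewrite -[X in measurable X]setCK; apply: measurableC; apply: borel_open.
rewrite (_ : ~` _ = (fun z : E => `|z|) @^-1` [set x | c < x]).
  by move/continuousP: (@norm_continuous _ E); apply; exact: open_gt.
by apply/seteqP; split=> z /=; rewrite real_ltNge ?num_real//; move/negP.
Qed.

(** The integral against the Levy measure is a sum over the jumps; it converges
    absolutely because cos x - 1 and sin x - x are dominated by x^2. The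
    drift is kept apart from the imaginary part. *)
Lemma exponent_compensated f :
  series (fun k => cos (lam k * f (e_ k)) - 1) @ \oo --> complex.Re (exponent f) /\
  series (fun k => sin (lam k * f (e_ k)) - lam k * f (e_ k)) @ \oo -->
    complex.Im (exponent f) - f jump_total.
Proof.
have df : measurable_fun [set: borel E] (f : borel E -> R).
  by apply: borel_continuous_real; exact: dual_continuous.
have mcos : measurable_fun [set: borel E] (fun z => cos (f z) : R).
  apply: (measurableT_comp (f := cos)) => //.
  by apply: continuous_measurable_fun; exact: continuous_cos.
have msin : measurable_fun [set: borel E] (fun z => sin (f z) : R).
  apply: (measurableT_comp (f := sin)) => //.
  by apply: continuous_measurable_fun; exact: continuous_sin.
have kE n : \1_[set z : E | `|z| <= sup (range lam)] (lam n *: e_ n) = 1 :> R.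
  by rewrite indicE mem_set//=; exact: jump_norm_le.
set S := `|jump_total| ^+ 2 * ((`|f| + `|0 : dual E|) * `|f - 0|).
have f0 N : series (fun k => `|cos (lam k * f (e_ k)) - 1|) N <= S.
  have := @jump_square_sum cos f 0 N (@cos_dist _).
  apply: le_trans; apply: ler_sum => k _.
  by rewrite -[(0 : dual E) _]/0 mulr0 cos0.
have f1 N :
    series (fun k => `|sin (lam k * f (e_ k)) - lam k * f (e_ k)|) N <= S.
  have := @jump_square_sum (fun x => sin x - x) f 0 N (@sin_sub_dist _).
  apply: le_trans; apply: ler_sum => k _.
  by rewrite -[(0 : dual E) _]/0 mulr0 sin0 !subr0.
split.
  rewrite /exponent /levy_khintchine /cintegral /= add0r.
  rewrite (_ : (fun k => _) = (fun z : E => expR 0 * cos (f z) - 1 - 0) \o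
      (fun n => lam n *: e_ n)); last first.
    by apply/funext => k /=; rewrite expR0 mul1r subr0 jump_dual.
  apply: (@Rintegral_series_dirac _ (borel E) R (fun n => lam n *: e_ n) _ S).
    by do 2 apply: measurable_funB => //; exact: measurable_funM.
  move=> N; apply: le_trans (f0 N); apply: ler_sum => k _.
  by rewrite expR0 mul1r subr0 jump_dual.
rewrite /exponent /levy_khintchine /cintegral /= jump_total_lim addrAC subrr add0r.
rewrite (_ : (fun k => _) = (fun z : E => expR 0 * sin (f z) - 0 -
   \1_[set z : E | `|z| <= sup (range lam)] z * f z) \o
   (fun n => lam n *: e_ n)); last first.
  by apply/funext => k /=; rewrite kE expR0 !mul1r subr0 jump_dual.
apply: (@Rintegral_series_dirac _ (borel E) R (fun n => lam n *: e_ n) _ S).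
  apply: measurable_funB; last first.
    by apply: measurable_funM => //; exact: ball_indic_measurable.
  by apply: measurable_funB => //; exact: measurable_funM.
move=> N; apply: le_trans (f1 N); apply: ler_sum => k _.
by rewrite kE expR0 !mul1r subr0 jump_dual.
Qed.

Lemma exponent_Re f :
  series (fun k => cos (lam k * f (e_ k)) - 1) @ \oo --> complex.Re (exponent f).
Proof. by have [] := exponent_compensated f. Qed.

(** The compensator and the drift cancel: both are the series of the
    lam k * f (e_k). *)
Lemma exponent_Im f :
  series (fun k => sin (lam k * f (e_ k))) @ \oo --> complex.Im (exponent f).
Proof.
have [_ c] := exponent_compensated f.
rewrite -(subrK (f jump_total) (complex.Im _)).
rewrite (_ : (fun k => _) =
    (fun k => sin (lam k * f (e_ k)) - lam k * f (e_ k)) \+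
    (fun k => lam k * f (e_ k))).
  by rewrite seriesD; apply: cvgD => //; exact: dual_series.
by apply/funext => k /=; rewrite subrK.
Qed.

Lemma exponent_dist f g :
  `|complex.Re (exponent f) - complex.Re (exponent g)| +
  `|complex.Im (exponent f) - complex.Im (exponent g)| <=
  (2 * `|jump_total| ^+ 2 * (`|f| + `|g|) + `|jump_total|) * `|f - g|.
Proof.
have bd (F : R -> R) (a b : R) :
    (forall x y, `|F x - F y| <= (`|x| + `|y|) * `|x - y|) ->
    series (fun k => F (lam k * f (e_ k))) @ \oo --> a ->
    series (fun k => F (lam k * g (e_ k))) @ \oo --> b ->
    `|a - b| <= `|jump_total| ^+ 2 * ((`|f| + `|g|) * `|f - g|).
  move=> FP ca cb.
  have cab : `|series (fun k => F (lam k * f (e_ k))) N -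
      series (fun k => F (lam k * g (e_ k))) N| @[N --> \oo] --> `|a - b|.
    by apply: cvg_norm; exact: cvgB.
  apply: (cvgr_to_le cab); apply: nearW => N.
  apply: le_trans (jump_square_sum f g N FP).
  by rewrite /series/= -sumrB; exact: ler_norm_sum.
have [f1 f2] := exponent_compensated f; have [g1 g2] := exponent_compensated g.
have cos1 (x y : R) : `|(cos x - 1) - (cos y - 1)| <= (`|x| + `|y|) * `|x - y|.
  by rewrite opprB addrA subrK; exact: cos_dist.
have h1 := bd (fun x => cos x - 1) _ _ cos1 f1 g1.
have := bd (fun x => sin x - x) _ _ (@sin_sub_dist _) f2 g2 => h2.
have h3 : `|f jump_total - g jump_total| <= `|f - g| * `|jump_total|.
  by rewrite -dualB dual_le_norm.
have h4 (a b c d : R) : `|a - b| <= `|a - c - (b - d)| + `|c - d|.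
  have -> : a - b = (a - c - (b - d)) + (c - d) by ring.
  exact: ler_normD.
have h5 := h4 (complex.Im (exponent f)) (complex.Im (exponent g))
  (f jump_total) (g jump_total).
apply: (le_trans (lerD h1 (le_trans h5 (lerD h2 h3)))).
by rewrite le_eqVlt; apply/orP; left; apply/eqP; ring.
Qed.

Lemma exponent0 : exponent 0 = 0.
Proof.
have l0 (u : nat -> R) (l : R) : (forall k, u k = 0) ->
    series u @ \oo --> l -> l = 0.
  move=> u0 ul; apply: (cvg_unique _ ul) => //.
  rewrite (_ : series u = cst 0); first exact: cvg_cst.
  by apply/funext => N; rewrite /series/= big1.
have re0 : complex.Re (exponent 0) = 0.
  apply: (l0 _ _ _ (@exponent_Re 0)) => k.
  by rewrite -[(0 : dual E) _]/0 mulr0 cos0 subrr.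
have im0 : complex.Im (exponent 0) = 0.
  apply: (l0 _ _ _ (@exponent_Im 0)) => k.
  by rewrite -[(0 : dual E) _]/0 mulr0 sin0.
by case: (exponent 0) re0 im0 => a b /= -> ->.
Qed.

Lemma exponent_continuous : continuous (exponent : dual E -> R[i]^o).
Proof.
move=> f; apply/(@cvgrPdist_lt R[i] R[i]^o (dual E) (nbhs f) _ exponent
  (exponent f)) => e e0.
have [r r0 er] : exists2 r : R, 0 < r & e = r%:C%C.
  move: e0; rewrite ltcE/= => /andP[/eqP ei er]; exists (complex.Re e) => //.
  by case: e ei er => a b /= ->.
(* A Lipschitz constant on the ball of radius 1 around f, from exponent_dist. *)
set K := 2 * `|jump_total| ^+ 2 * (`|f| + `|f| + 1) + `|jump_total|.
have K0 : 0 <= K by rewrite addr_ge0// mulr_ge0// ?mulr_ge0// !addr_ge0.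
have rK : 0 < r / (K + 1) by rewrite divr_gt0// ltr_wpDl.
near=> g.
have fg1 : `|f - g| < 1 by near: g; exact: cvgr_dist_lt.
have fgr : `|f - g| < r / (K + 1) by near: g; exact: cvgr_dist_lt.
have gf : `|g| <= `|f| + 1.
  rewrite -[g in leLHS](subrK f) (le_trans (ler_normD _ _))// addrC lerD2l.
  by rewrite distrC ltW.
have := exponent_dist f g => h.
have h' : `|complex.Re (exponent f) - complex.Re (exponent g)| +
  `|complex.Im (exponent f) - complex.Im (exponent g)| < r.
  apply: (le_lt_trans h); apply: (@le_lt_trans _ _ (K * `|f - g|)).
    rewrite ler_wpM2r// lerD2r ler_wpM2l// ?mulr_ge0//; lra.
  apply: (@le_lt_trans _ _ ((K + 1) * `|f - g|)).
    by rewrite ler_wpM2r// lerDl.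
  by rewrite mulrC -ltr_pdivlMr// ltr_wpDl.
rewrite er normc_def ltcR (le_lt_trans _ h')//.
case: (exponent f) (exponent g) {h h'} => a b [c d] /=.
rewrite -(@ler_pXn2r _ 2)// ?nnegrE ?sqrtr_ge0 ?addr_ge0//.
rewrite sqr_sqrtr ?addr_ge0 ?sqr_ge0// [leRHS]sqrrD !real_normK ?num_real//.
by rewrite lerD2r lerDl mulrn_wge0// mulr_ge0.
Unshelve. all: by end_near. Qed.

Context (mu : probability (borel E) R)
  (mu_charfun : forall f, charfun mu f = cexp (exponent f)).

Lemma continuous_log_charfun : continuous_log (charfun mu) = exponent.
Proof.
have el : is_continuous_log (charfun mu) exponent.
  split; [exact: exponent_continuous|exact: exponent0|].
  by move=> f; rewrite mu_charfun.
by apply: (continuous_log_unique _ el); apply: xgetPex; exists exponent.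
Qed.

(** With a = lam k * f (e_k) and b = lam k * g (e_k), the codifference is the
    series of the terms (exp (i (a - b)) - 1) - (exp (i a) - 1) - (exp (- i b) - 1),
    which factor as (exp (i a) - 1) (exp (- i b) - 1). *)
Lemma codifference_le f g (B : \bar R) :
    (forall N, (\sum_(k < N) ComplexField.Normc.normc
      ((cis (lam k * f (e_ k)) - 1) * (cis (- (lam k * g (e_ k))) - 1)))%:E <= B)%E ->
  ((ComplexField.Normc.normc (codifference mu f g))%:E <= B)%E.
Proof.
pose u k := (cis (lam k * f (e_ k)) - 1) * (cis (- (lam k * g (e_ k))) - 1).
have uE k : u k = cis (lam k * (f - g) (e_ k)) - cis (lam k * f (e_ k)) -
    cis (lam k * (- g) (e_ k)) + 1.
  rewrite /u dualB dualN [lam k * (_ - _)]mulrBr [lam k * - _]mulrN cisD.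
  by ring.
have cvg3 (a b c : nat -> R) (x y z : R) : series a @ \oo --> x ->
    series b @ \oo --> y -> series c @ \oo --> z ->
    series (fun k => a k - b k - c k) @ \oo --> x - y - z.
  move=> ax bx cx; rewrite (_ : series _ = series a - series b - series c).
    by apply: cvgB; [exact: cvgB|].
  by apply/funext => N; rewrite !fctE /series/= !sumrB.
have ReB (x y : R[i]) : complex.Re (x - y) = complex.Re x - complex.Re y.
  by rewrite raddfB.
have ImB (x y : R[i]) : complex.Im (x - y) = complex.Im x - complex.Im y.
  by rewrite raddfB.
move=> uB; apply: (@series_normc_le _ u) => //;
  rewrite /codifference continuous_log_charfun.
  rewrite !ReB.
  rewrite (_ : _ \o u = (fun k => (cos (lam k * (f - g) (e_ k)) - 1) -
      (cos (lam k * f (e_ k)) - 1) - (cos (lam k * (- g) (e_ k)) - 1))).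
    by apply: cvg3; exact: exponent_Re.
  apply/funext => k; rewrite -[LHS]/(complex.Re (u k)) uE.
  by rewrite !raddfD !raddfN /=; ring.
rewrite !ImB.
rewrite (_ : _ \o u = (fun k => sin (lam k * (f - g) (e_ k)) -
    sin (lam k * f (e_ k)) - sin (lam k * (- g) (e_ k)))).
  by apply: cvg3; exact: exponent_Im.
apply/funext => k; rewrite -[LHS]/(complex.Im (u k)) uE.
by rewrite !raddfD !raddfN /=; ring.
Qed.

Context (omega : nat -> R) (lamS : forall n, lam n.+1 * omega n = lam n).
Context (T : {linear E -> E}) (cT : continuous T) (T0 : T (e_ 0) = 0).
Context (TS : forall n, T (e_ n.+1) = omega n *: e_ n).

(** The operator T moves each jump onto the previous one. *)
Lemma adjoint_jump g k :
  lam k * adjoint cT g (e_ k) = if k is l.+1 then lam l * g (e_ l) else 0.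
Proof.
rewrite -[adjoint cT g (e_ k)]/(g (T (e_ k))).
case: k => [|l]; first by rewrite T0 linear0 mulr0.
by rewrite TS linearZ mulrA lamS.
Qed.

Lemma adjoint_iter_jump n g k :
  lam k * iter n (adjoint cT) g (e_ k) =
  if (k < n)%N then 0 else lam (k - n) * g (e_ (k - n)).
Proof.
elim: n k => [|n IH] [|k]; rewrite ?subn0//.
  by rewrite iterS adjoint_jump.
by rewrite iterS adjoint_jump IH ltnS subSS.
Qed.

(** The first n terms of the codifference vanish and the term of index l + n
    involves f along e_(l + n) and g along e_l only. Each factor is bounded by
    [normc_cis_sub1_le] with r = p / 2, so that the constant is
    (2^(1 - p / 2))^2 = 2^(2 - p). *)
Lemma codifference_adjoint_le n f g :
  ((ComplexField.Normc.normc (codifference mu f (iter n (adjoint cT) g)))%:E <=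
   (2 `^ (2 - p) * (`|f| `^ (p / 2) * `|g| `^ (p / 2)))%:E *
   \sum_(0 <= l <oo) ((lam l * lam (l + n)%N) `^ (p / 2))%:E)%E.
Proof.
set r := p / 2; set C := 2 `^ (2 - p) * _.
have p0 := ellp_exponent_gt0 p1.
have r01 : 0 <= r <= 1.
  by rewrite /r divr_ge0 ?(ltW p0)//= ler_pdivrMr// mul1r ltW.
have C0 : 0 <= C by rewrite mulr_ge0 ?powR_ge0// mulr_ge0 ?powR_ge0.
apply: codifference_le => N.
apply: (@le_trans _ _ (C%:E *
    (\sum_(0 <= l < N) ((lam l * lam (l + n)%N) `^ r)%:E))%E); last first.
  rewrite lee_wpmul2l ?lee_fin//; apply: nneseries_lim_ge => l _ _.
  by rewrite lee_fin powR_ge0.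
rewrite sumEFin -EFinM lee_fin mulr_sumr.
pose F k := ComplexField.Normc.normc ((cis (lam k * f (e_ k)) - 1) *
  (cis (- (lam k * iter n (adjoint cT) g (e_ k))) - 1)).
have n0 (z : R[i]) : 0 <= ComplexField.Normc.normc z.
  by case: z => a b; exact: sqrtr_ge0.
have powle (x y : R) : `|x| <= y -> `|x| `^ r <= y `^ r.
  move=> xy; have /andP[r0 _] := r01.
  by rewrite ge0_ler_powR// nnegrE (le_trans _ xy).
have F0 k : (k < n)%N -> F k = 0.
  move=> kn; rewrite /F adjoint_iter_jump kn oppr0 cis0 subrr mulr0.
  by rewrite ComplexField.Normc.normc0.
have FE l : F (l + n)%N <= C * (lam l * lam (l + n)%N) `^ r.
  have gE : lam (l + n)%N * iter n (adjoint cT) g (e_ (l + n)) =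
      lam l * g (e_ l).
    by rewrite adjoint_iter_jump ltnNge leq_addl/= addnK.
  rewrite /F gE ComplexField.Normc.normcM.
  have a0 := lam_gt0 (l + n)%N; have b0 := lam_gt0 l.
  have h1 : ComplexField.Normc.normc
      (cis (lam (l + n)%N * f (e_ (l + n))) - 1) <=
      2 `^ (1 - r) * (lam (l + n)%N * `|f|) `^ r.
    apply: (le_trans (normc_cis_sub1_le _ r01)); rewrite ler_wpM2l ?powR_ge0//.
    apply: powle; rewrite normrM gtr0_norm// ler_wpM2l ?(ltW a0)//.
    exact: dual_basis_le.
  have h2 : ComplexField.Normc.normc (cis (- (lam l * g (e_ l))) - 1) <=
      2 `^ (1 - r) * (lam l * `|g|) `^ r.
    apply: (le_trans (normc_cis_sub1_le _ r01)); rewrite ler_wpM2l ?powR_ge0//.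
    apply: powle; rewrite normrN normrM gtr0_norm// ler_wpM2l ?(ltW b0)//.
    exact: dual_basis_le.
  apply: (le_trans (ler_pM _ _ h1 h2)).
  - exact: n0.
  - exact: n0.
  rewrite !powRM ?(ltW a0) ?(ltW b0)// le_eqVlt; apply/orP; left; apply/eqP.
  have -> : C = 2 `^ (1 - r) * 2 `^ (1 - r) * (`|f| `^ r * `|g| `^ r).
    rewrite -powRD ?pnatr_eq0 ?implybT// /C; congr (_ `^ _ * _).
    by rewrite /r; field.
  ring.
rewrite (_ : \sum_(k < N) _ = \sum_(k < N) F k)//.
apply: (@le_trans _ _ (\sum_(0 <= k < n + N) F k)).
  rewrite -(big_mkord xpredT).
  rewrite (@big_cat_nat _ _ _ N 0%N (n + N)%N) ?leq_addl//= lerDl.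
  by apply: sumr_ge0 => k _; exact: n0.
rewrite (@big_cat_nat _ _ _ n 0%N (n + N)%N) ?leq_addr//= big_nat_cond.
rewrite big1 ?add0r => [|k /andP[/andP[_ kn] _]]; last exact: F0.
by rewrite -{1}[n]add0n big_addn addKn; apply: ler_sum => l _; exact: FE.
Qed.

(** * The coordinates are integer valued, independent and identically distributed *)

(** The number of jumps lam n e_n that make up z. *)
Definition jump_count n : dual E := (lam n)^-1 *: ellp_coord p1 n.

Lemma jump_countE n z : jump_count n z = z n / lam n.
Proof. by rewrite /jump_count dualZ ellp_coordE mulrC. Qed.

Lemma jump_count_jump n k : lam k * jump_count n (e_ k) = (k == n)%:R.
Proof.
rewrite jump_countE ellp_basisE eq_sym; case: eqVneq => [->|_]; last by rewrite mul0r mulr0.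
by rewrite mul1r divff// gt_eqF.
Qed.

(** Only the i-th jump sees the added functional, and there it takes the value t. *)
Lemma exponent_add_jump_count f i t : f (e_ i) = 0 ->
  exponent (f + t *: jump_count i) = exponent f + (cis t - 1).
Proof.
move=> fi.
have jE k : lam k * (f + t *: jump_count i) (e_ k) =
    lam k * f (e_ k) + t * (k == i)%:R.
  by rewrite dualD dualZ mulrDr mulrCA jump_count_jump.
have cvg1 (F : R -> R) (x y : R) : F 0 = 0 ->
    series (fun k => F (lam k * (f + t *: jump_count i) (e_ k))) @ \oo --> x ->
    series (fun k => F (lam k * f (e_ k))) @ \oo --> y -> x = y + F t.
  move=> F0 cx cy; apply: (cvg_unique _ cx) => //.
  apply: (@cvg_trans _
    ((series (fun k => F (lam k * f (e_ k))) N + F t) @[N --> \oo]));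
    last first.
    by apply: cvgD => //; exact: cvg_cst.
  apply: near_eq_cvg; near=> N.
  have iN : (i < N)%N by near: N; exact: nbhs_infty_gt.
  have sE (u : nat -> R) n : series u n = \sum_(k < n) u k.
    by rewrite /series/= big_mkord.
  rewrite !sE (bigD1 (Ordinal iN))// [in RHS](bigD1 (Ordinal iN))//.
  rewrite jE fi mulr0 F0 eqxx mulr1 !add0r addrC; congr (_ + _).
  rewrite [LHS]add0r; apply: eq_bigr => k; rewrite -val_eqE/= => /negPf ki.
  by rewrite jE ki mulr0 addr0.
have hr := cvg1 (fun x => cos x - 1) _ _ _ (@exponent_Re _) (@exponent_Re f).
have hi := cvg1 sin _ _ _ (@exponent_Im _) (@exponent_Im f).
move: hr hi; rewrite cos0 subrr sin0 => /(_ erefl) hr /(_ erefl) hi.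
move: hr hi; case: (exponent _) (exponent f) => a b [c d] /= -> ->.
by apply/eqP; rewrite eq_complex/= subr0 !eqxx.
Unshelve. all: by end_near. Qed.

Lemma dual_measurable f : measurable_fun [set: borel E] (f : borel E -> R).
Proof. by apply: borel_continuous_real; exact: dual_continuous. Qed.

Lemma cos_dual_bounded f a :
  bounded_measurable (fun z : borel E => cos (f z + a)).
Proof.
split; last by exists 1 => z; exact: cos_max.
apply: (measurableT_comp (f := cos)).
  by apply: continuous_measurable_fun; exact: continuous_cos.
by apply: measurable_funD => //; exact: dual_measurable.
Qed.

(** A phase a is kept so that both the real and the imaginary part of the
    characteristic functional are covered by a statement on real integrals. *)
Lemma integral_cos f a : \int[mu]_z cos (f z + a) =
  complex.Re (cis a * cexp (exponent f)).
Proof.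
rewrite -mu_charfun.
have bc : bounded_measurable (fun z : borel E => cos (f z)).
  by have := cos_dual_bounded f 0; under eq_fun do rewrite addr0.
have bs : bounded_measurable (fun z : borel E => sin (f z)).
  have := cos_dual_bounded f (- (pi / 2)).
  by under eq_fun do rewrite cosBpihalf.
have ic := bounded_measurable_integrable mu measurableT bc.
have is_ := bounded_measurable_integrable mu measurableT bs.
rewrite /charfun /cintegral /=.
under [X in _ = _ * X - _]eq_Rintegral do rewrite expR0 mul1r.
under [X in _ = _ - _ * X]eq_Rintegral do rewrite expR0 mul1r.
rewrite -!RintegralZl//.
rewrite -RintegralB//.
- by apply: eq_Rintegral => z _; rewrite cosD; ring.
- exact: (bounded_measurable_integrable mu measurableT (bounded_measurableZ _ bc)).
- exact: (bounded_measurable_integrable mu measurableT (bounded_measurableZ _ bs)).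
Qed.

Definition residue_set (M : nat) (I : seq nat) (k : nat -> int) : set (borel E) :=
  [set z | forall i, i \in I -> (jump_count i z - (k i)%:~R) / M%:R \is a Num.int].

Lemma residue_set_cons M i I k : residue_set M (i :: I) k =
  residue_set M I k `&` [set z | (jump_count i z - (k i)%:~R) / M%:R \is a Num.int].
Proof.
apply/seteqP; split=> [z h|z [hI hi]].
  by split=> [j jI|]; apply: h; rewrite ?inE ?eqxx ?jI ?orbT.
by move=> j; rewrite inE => /orP[/eqP ->|/hI].
Qed.

Lemma residue_set_nil M k : residue_set M [::] k = setT.
Proof. by apply/seteqP; split. Qed.

Lemma residue_measurable M i (x : int) : measurable
  ([set z | (jump_count i z - x%:~R) / M%:R \is a Num.int] : set (borel E)).
Proof.
apply: (measurable_int_valued (F := fun z : borel E => (jump_count i z - x%:~R) / M%:R)).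
apply: measurable_funM => //; apply: measurable_funB => //.
exact: dual_measurable.
Qed.

Lemma residue_set_measurable M I k : measurable (residue_set M I k).
Proof.
elim: I => [|i I IH]; first by rewrite residue_set_nil.
by rewrite residue_set_cons; apply: measurableI => //; exact: residue_measurable.
Qed.

Lemma jump_count_int_measurable i :
  measurable ([set z | jump_count i z \is a Num.int] : set (borel E)).
Proof.
apply: (measurable_int_valued (F := fun z : borel E => jump_count i z)).
exact: dual_measurable.
Qed.

(** The exponent of 2 pi times the i-th jump count is exp (2 i pi) - 1 = 0. *)
Lemma jump_count_int_full i :
  mu (~` ([set z | jump_count i z \is a Num.int] : set (borel E))) = 0%E.
Proof.
apply: (int_valued_full (F := fun z : borel E => jump_count i z)).
  exact: dual_measurable.
have := integral_cos (0 + (2 * pi) *: jump_count i) 0.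
rewrite exponent_add_jump_count// exponent0 add0r.
have /cis_2pi_int := int_num1 R; rewrite mulr1 => ->.
rewrite subrr addr0 cis0 mul1r cexp0 => h.
transitivity (complex.Re (1 : R[i])) => //; rewrite -h.
by apply: eq_Rintegral => z _; rewrite addr0.
Qed.

(** By discrete Fourier inversion on Z/MZ, the probability that a Poisson variable
    of mean 1 is congruent to x modulo M. *)
Definition fourier_coef (M : nat) (x : int) : R[i] :=
  M%:R^-1 * \sum_(j < M) cis (- (2 * pi * (j%:R * (x%:~R / M%:R)))) *
    cexp (cis (2 * pi * (j%:R / M%:R)) - 1).

(** By induction on I: the indicator of the residue class of the i-th count is an
    average of M characters, and each of them changes f by a multiple of that
    count without affecting the other indices. The phase a and the functional f
    are there to make the induction go through. *)
Lemma integral_residue M I k f a : (0 < M)%N -> uniq I ->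
    (forall i, i \in I -> f (e_ i) = 0) ->
  \int[mu]_(z in residue_set M I k) cos (f z + a) =
  complex.Re (cis a * cexp (exponent f) * \prod_(i <- I) fourier_coef M (k i)).
Proof.
move=> M0; elim: I f a => [|i I IH] f a /=.
  by rewrite big_nil mulr1 residue_set_nil integral_cos.
move=> /andP[iI uI] fI; rewrite residue_set_cons.
have mI := residue_set_measurable M I k.
have mi := residue_measurable M i (k i).
have mL := jump_count_int_measurable i.
have L0 := jump_count_int_full i.
pose g j : dual E := f + (2 * pi * (j%:R / M%:R)) *: jump_count i.
(* The functional and the phase of the j-th character of Z/MZ at N_i - k i. *)
pose b j := a - 2 * pi * (j%:R * ((k i)%:~R / M%:R)).
pose G j z := M%:R^-1 * cos (g j z + b j).
have bG j : bounded_measurable (G j : borel E -> R).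
  by apply: bounded_measurableZ; exact: cos_dual_bounded.
have -> : \int[mu]_(z in residue_set M I k `&`
      [set z | (jump_count i z - (k i)%:~R) / M%:R \is a Num.int]) cos (f z + a) =
    \int[mu]_(z in residue_set M I k) (\sum_(j < M) G j z).
  rewrite -(Rintegral_full_set _ mL L0)//; last 2 first.
  - exact: measurableI.
  - exact: cos_dual_bounded.
  rewrite -[RHS](Rintegral_full_set mI mL L0); last exact: bounded_measurable_sum.
  (* The two integrands agree only where the i-th count is an integer. *)
  rewrite setIAC Rintegral_mkcondr; apply: eq_Rintegral => z.
  rewrite inE => -[_ zL].
  rewrite -mulr_sumr patchE.
  set x := (jump_count i z - (k i)%:~R) / M%:R.
  have Mx : M%:R * x \is a Num.int.
    by rewrite mulrC divfK ?pnatr_eq0 ?gtn_eqF// rpredB ?intr_int.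
  have -> : \sum_(j < M) cos (g j z + b j) =
      complex.Re (cis (f z + a) * \sum_(j < M) cis (2 * pi * (j%:R * x))).
    rewrite mulr_sumr raddf_sum; apply: eq_bigr => j _.
    rewrite -cisD -[RHS]/(cos _); congr cos.
    by rewrite /b dualD dualZ /x; ring.
  have ReM (w : R[i]) : complex.Re (w * M%:R) = M%:R * complex.Re w.
    by rewrite mulr_natr raddfMn mulr_natl.
  rewrite sum_cis_period//.
  have [xi|xi] := boolP (x \is a Num.int).
    rewrite mem_set// (ReM (cis _)) mulrA mulVf ?mul1r//.
    by rewrite pnatr_eq0 gtn_eqF.
  by rewrite memNset; [rewrite mulr0/= mulr0|exact/negP].
rewrite Rintegral_sum//.
have ReV (w : R[i]) : complex.Re (M%:R^-1 * w) = M%:R^-1 * complex.Re w.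
  rewrite -(rmorph_nat (real_complex R)) -fmorphV.
  by case: w => u v /=; rewrite mul0r subr0.
transitivity (\sum_(j < M) complex.Re (M%:R^-1 * (cis (b j) *
    cexp (exponent (g j)) * \prod_(i <- I) fourier_coef M (k i)))).
  apply: eq_bigr => j _.
  rewrite RintegralZl//; last first.
    by apply: bounded_measurable_integrable => //; exact: cos_dual_bounded.
  rewrite IH//; last first.
    move=> l lI; rewrite dualD dualZ fI ?inE ?lI ?orbT// add0r.
    have := jump_count_jump i l; case: eqVneq => [li|_ /eqP].
      by rewrite -li lI in iI.
    by rewrite mulf_eq0 gt_eqF//= => /eqP ->; rewrite mulr0.
rewrite -raddf_sum; congr complex.Re.
rewrite big_cons; set Q := \prod_(j <- I) _.
transitivity (\sum_(j < M) cis a * cexp (exponent f) * M%:R^-1 * Q *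
    (cis (- (2 * pi * (j%:R * ((k i)%:~R / M%:R)))) *
     cexp (cis (2 * pi * (j%:R / M%:R)) - 1))).
  apply: eq_bigr => j _; rewrite exponent_add_jump_count ?fI ?mem_head//.
  by rewrite cexpD cisD; ring.
by rewrite -mulr_sumr /fourier_coef; ring.
Qed.

(** On a single count, the phase pi / 2 turns the cosine into 0 and the real part
    into minus the imaginary part. *)
Lemma fourier_coef_real M (x : int) : (0 < M)%N ->
  complex.Im (fourier_coef M x) = 0.
Proof.
move=> M0; have := @integral_residue M [:: 0%N] (fun=> x) 0 (pi / 2) M0 isT.
move=> /(_ (fun=> fun=> erefl)).
rewrite big_seq1 exponent0 cexp0 mulr1.
have -> : complex.Re (cis (pi / 2) * fourier_coef M x) =
    - complex.Im (fourier_coef M x).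
  rewrite /cis cos_pihalf sin_pihalf; case: (fourier_coef M x) => u v /=.
  by rewrite mul0r mul1r sub0r.
under eq_Rintegral do rewrite add0r cos_pihalf.
rewrite Rintegral_cst ?mul0r; last exact: residue_set_measurable.
by move/eqP; rewrite eq_sym oppr_eq0 => /eqP.
Qed.

Lemma residue_set_mass M I k : (0 < M)%N -> uniq I ->
  fine (mu (residue_set M I k)) =
  \prod_(i <- I) complex.Re (fourier_coef M (k i)).
Proof.
move=> M0 uI; have := @integral_residue M I k 0 0 M0 uI (fun=> fun=> erefl).
under eq_Rintegral do rewrite add0r cos0.
rewrite Rintegral_cst ?mul1r; last exact: residue_set_measurable.
move=> ->; rewrite exponent0 cexp0 cis0 !mul1r.
rewrite (eq_bigr (fun i => (complex.Re (fourier_coef M (k i)))%:C%C)); last first.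
  move=> i _; have := fourier_coef_real (k i) M0.
  by case: (fourier_coef M (k i)) => u v /= ->.
by rewrite -(rmorph_prod (real_complex R)).
Qed.

Definition cylinder (I : seq nat) (k : nat -> int) : set (borel E) :=
  [set z | forall i, i \in I -> jump_count i z = (k i)%:~R].

Lemma int_divisible_eq0 (x : R) :
  (forall m, x / (2 ^ m)%N%:R \is a Num.int) -> x = 0.
Proof.
move=> xi; apply/eqP/negPn/negP => x0.
have [m xm] : exists m : nat, `|x| < (2 ^ m)%N%:R.
  exists (Num.bound `|x|); apply: (lt_trans (archi_boundP (normr_ge0 x))).
  by rewrite ltr_nat ltn_expl.
have x1 : 1 <= `|x / (2 ^ m)%N%:R|.
  apply: norm_intr_ge1; first exact: xi.
  by rewrite mulf_neq0// invr_eq0 pnatr_eq0 expn_eq0.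
have m0 : 0 < (2 ^ m)%N%:R :> R by rewrite ltr0n expn_gt0.
move: x1; rewrite normrM normfV (gtr0_norm m0) ler_pdivlMr// mul1r.
by rewrite leNgt xm.
Qed.

(** Only 0 stays an integer after division by every power of 2. *)
Lemma residue_set_bigcap I k : \bigcap_m residue_set (2 ^ m) I k = cylinder I k.
Proof.
apply/seteqP; split=> z /= h.
  move=> i iI; apply/eqP; rewrite -subr_eq0; apply/eqP.
  by apply: int_divisible_eq0 => m; exact: h.
by move=> m _ i iI; rewrite h// subrr mul0r int_num0.
Qed.

Lemma residue_set_pow_decr I k :
  {homo (fun m => residue_set (2 ^ m) I k) : n m / (n <= m)%N >-> (m <= n)%O}.
Proof.
move=> n m nm; apply/subsetPset => z h i iI.
suff -> : (jump_count i z - (k i)%:~R) / (2 ^ n)%N%:R =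
    (jump_count i z - (k i)%:~R) / (2 ^ m)%N%:R * (2 ^ (m - n))%N%:R.
  by rewrite rpredM ?natr_int//; exact: h.
have n0 (j : nat) : (2 ^ j)%N%:R != 0 :> R by rewrite pnatr_eq0 expn_eq0.
by rewrite -[in (2 ^ m)%N](subnK nm) expnD natrM; field; rewrite !n0.
Qed.

Lemma cylinder_measurable I k : measurable (cylinder I k).
Proof.
rewrite -residue_set_bigcap; apply: bigcapT_measurable => m.
exact: residue_set_measurable.
Qed.

Lemma residue_set_cvg I k :
  fine (mu (residue_set (2 ^ m) I k)) @[m --> \oo] --> fine (mu (cylinder I k)).
Proof.
have : (mu \o (fun m => residue_set (2 ^ m) I k)) m @[m --> \oo] -->
    mu (\bigcap_m residue_set (2 ^ m) I k).
  apply: nonincreasing_cvg_mu.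
  - by rewrite -ge0_fin_numE// fin_num_measure//; exact: residue_set_measurable.
  - by move=> m; exact: residue_set_measurable.
  - by rewrite residue_set_bigcap; exact: cylinder_measurable.
  - exact: residue_set_pow_decr.
rewrite residue_set_bigcap -[X in _ --> X]fineK; last first.
  by rewrite fin_num_measure//; exact: cylinder_measurable.
by move=> /fine_cvgP[].
Qed.

Definition jump_count_mass (x : int) : R := fine (mu (cylinder [:: 0%N] (fun=> x))).

(** Independence and equidistribution of the counts: the factor does not depend
    on i, because the Fourier coefficients do not. *)
Lemma cylinder_mass I k : uniq I ->
  fine (mu (cylinder I k)) = \prod_(i <- I) jump_count_mass (k i).
Proof.
move=> uI; apply: (cvg_unique _ (@residue_set_cvg I k)) => //.
rewrite (_ : (fun m => _) = (fun m => \prod_(i <- I)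
    fine (mu (residue_set (2 ^ m) [:: 0%N] (fun=> k i))))); last first.
  apply/funext => m; rewrite residue_set_mass ?expn_gt0//.
  by apply: eq_bigr => i _; rewrite residue_set_mass ?expn_gt0// big_seq1.
apply: cvg_big => //; first exact: mul_continuous.
by move=> i _; exact: residue_set_cvg.
Qed.

(** The points all of whose jump counts are integers; mu is carried by them. *)
Definition lattice : set (borel E) := [set z | forall i, jump_count i z \is a Num.int].

Lemma lattice_bigcap :
  lattice = \bigcap_i ([set z | jump_count i z \is a Num.int] : set (borel E)).
Proof.
by apply/seteqP; split=> z h; [move=> i _; exact: h|move=> i; exact: h].
Qed.

Lemma lattice_measurable : measurable lattice.
Proof.
rewrite lattice_bigcap; apply: bigcapT_measurable => i.
exact: jump_count_int_measurable.
Qed.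

Lemma lattice_full : mu (~` lattice) = 0%E.
Proof.
have : mu.-negligible (~` lattice).
  rewrite lattice_bigcap setC_bigcap; apply: negligible_bigcup => i.
  apply/negligibleP; first by apply: measurableC; exact: jump_count_int_measurable.
  exact: jump_count_int_full.
by move/negligibleP; apply; apply: measurableC; exact: lattice_measurable.
Qed.

Lemma mu_setI_lattice A : measurable A -> mu (A `&` lattice) = mu A.
Proof.
move=> mA; rewrite [RHS](measureDI mu mA lattice_measurable).
rewrite [X in (X + _)%E](_ : _ = 0%E) ?add0e//.
apply: (@subset_measure0 _ _ _ mu _ (~` lattice)) => //.
- by apply: measurableD => //; exact: lattice_measurable.
- by apply: measurableC; exact: lattice_measurable.
- exact: lattice_full.
Qed.

Lemma mu_eq_on_lattice A B : measurable A -> measurable B ->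
  A `&` lattice = B `&` lattice -> mu A = mu B.
Proof.
move=> mA mB AB; transitivity (mu (A `&` lattice)).
  by rewrite mu_setI_lattice.
by rewrite AB mu_setI_lattice.
Qed.

(** The empty set is added to make the family stable under intersection. *)
Definition cylinder_family : set (set (borel E)) :=
  [set A | A = set0 \/ exists I k, A = cylinder I k].

Lemma cylinder_familyI : setI_closed cylinder_family.
Proof.
move=> A B [->|[I [k ->]]]; first by rewrite set0I; left.
move=> [->|[J [l ->]]]; first by rewrite setI0; left.
have [AB0|/set0P[z0 [z0I z0J]]] := eqVneq (cylinder I k `&` cylinder J l) set0.
  by left.
(* The intersection is not empty, so k and l agree on the common indices. *)
right; exists (I ++ J), (fun i => if i \in I then k i else l i).
apply/seteqP; split=> [z [zI zJ] i|z zIJ].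
  by rewrite mem_cat; case: ifPn => [iI _|_ /= iJ]; [exact: zI|exact: zJ].
split=> i iX; have := zIJ i; rewrite mem_cat iX ?orbT => /(_ isT) ->//.
case: ifPn => // iI; by rewrite -z0I// z0J.
Qed.

Lemma cylinder_family_measurable : cylinder_family `<=` measurable.
Proof. by move=> A [->|[I [k ->]]] //; exact: cylinder_measurable. Qed.

Lemma cylinder_family_sigma A : <<s cylinder_family >> A -> measurable A.
Proof.
apply: smallest_sub; last exact: cylinder_family_measurable.
exact: sigma_algebra_measurable.
Qed.

(** Every truncation of a point of the lattice has this form, so there are only
    countably many of them. *)
Definition lattice_point (t : seq int) : E :=
  \sum_(i < size t) (lam i * (nth 0 t i)%:~R) *: e_ i.

Lemma trunc_lattice N (t : seq int) (z : E) : size t = N ->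
  cylinder (iota 0 N) (nth 0 t) z -> trunc N z = lattice_point t.
Proof.
move=> <- zt; rewrite /trunc /lattice_point; apply: eq_bigr => i _.
have := zt i; rewrite mem_iota leq0n add0n ltn_ord => /(_ isT) <-.
by rewrite jump_countE mulrCA divff ?mulr1// gt_eqF.
Qed.

Lemma lattice_cylinder N (z : E) : lattice z -> exists2 t : seq int, size t = N &
  cylinder (iota 0 N) (nth 0 t) z.
Proof.
move=> zL; exists (mkseq (fun i => Num.floor (jump_count i z)) N); first exact: size_mkseq.
move=> i; rewrite mem_iota add0n => /andP[_ iN]; rewrite nth_mkseq//.
by have := zL i; rewrite intrEfloor => /eqP.
Qed.

(** The trace on the lattice of the closed ball of center a and radius r, written
    with countably many cylinders: the condition on z is imposed on each of its
    truncations. *)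
Definition cylinder_ball (a : E) (r : R) : set (borel E) :=
  \bigcap_N \bigcup_(t in [set t : seq int | size t = N /\
    `|lattice_point t - trunc N a| <= r]) cylinder (iota 0 N) (nth 0 t).

Lemma sigma_countable_bigcup (I : countType) (S : pointedType) (G : set (set S))
    (D : set I) (F : I -> set S) :
  (forall i, D i -> <<s G >> (F i)) -> <<s G >> (\bigcup_(i in D) F i).
Proof.
move=> GF; rewrite bigcup_mkcond.
have cI : countable [set: I] by exact: countableP.
apply: (@countable_bigcupT_measurable _ (g_sigma_algebraType G) I _ cI) => i.
by case: ifPn => [/set_mem/GF//|_]; exact: sigma_algebra0.
Qed.

Lemma cylinder_ball_sigma a r : <<s cylinder_family >> (cylinder_ball a r).
Proof.
apply: (@bigcapT_measurable _ (g_sigma_algebraType cylinder_family)) => N.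
apply: sigma_countable_bigcup => t _; apply: sub_sigma_algebra; right.
by exists (iota 0 N), (nth 0 t).
Qed.

(** Truncation does not increase the norm and the truncations converge, so that the
    distance to a is at most r if and only if that of all truncations is. *)
Lemma cylinder_ballE a r :
  cylinder_ball a r `&` lattice = [set z | `|z - a| <= r] `&` lattice.
Proof.
apply/seteqP; split=> z [zB zL]; split=> //=.
  have cN : `|trunc N (z - a)| @[N --> \oo] --> `|z - a|.
    by apply: cvg_norm; exact: trunc_cvg.
  apply: (cvgr_to_le cN); apply: nearW => N.
  by have [t [tN ta] zt] := zB N Logic.I; rewrite truncB (trunc_lattice tN zt).
move=> N _; have [t tN zt] := lattice_cylinder N zL; exists t => //=; split=> //.
by rewrite -(trunc_lattice tN zt) -truncB (le_trans (trunc_norm_le _ _)).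
Qed.

(** An open set is, on the lattice, the union of the balls that it contains
    whose center is a lattice point of finite support and whose radius is the
    inverse of an integer. *)
Lemma open_cylinder (U : set E) : open U ->
  exists2 B, <<s cylinder_family >> B & U `&` lattice = B `&` lattice.
Proof.
move=> oU.
pose D := [set x : seq int * nat |
  [set z | `|z - lattice_point x.1| <= x.2.+1%:R^-1] `<=` U].
pose F (x : seq int * nat) := cylinder_ball (lattice_point x.1) x.2.+1%:R^-1.
exists (\bigcup_(x in D) F x).
  by apply: sigma_countable_bigcup => x _; exact: cylinder_ball_sigma.
apply/seteqP; split=> [z [zU zL]|z [[x xD xz] zL]]; split=> //; last first.
  apply: xD => /=.
  have : (cylinder_ball (lattice_point x.1) x.2.+1%:R^-1 `&` lattice) z by [].
  by rewrite cylinder_ballE => -[].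
have /nbhs_ballP[e /= e0 eU] : nbhs z U by exact: open_nbhs_nbhs.
have e2 : 0 < e / 2 by rewrite divr_gt0.
have [m em] : exists m : nat, m.+1%:R^-1 < e / 2.
  exists (Num.bound (e / 2)^-1).
  rewrite -[ltRHS]invrK ltf_pV2 ?posrE ?invr_gt0//.
  by rewrite (lt_trans (archi_boundP _))// ?invr_ge0 ?ltW// ltr_nat.
have /cvgrPdist_lt/(_ m.+1%:R^-1) := trunc_cvg z.
rewrite invr_gt0 ltr0n => /(_ isT) [N _ /(_ N (leqnn N))] /= zN.
have [t tN zt] := lattice_cylinder N zL.
have zl : `|z - lattice_point t| <= m.+1%:R^-1.
  by rewrite -(trunc_lattice tN zt) ltW.
(* The closed ball around lattice_point t contains z and has diameter at most
   2 / (m + 1) < e. *)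
exists (t, m).
  move=> y /= yl; apply: eU; rewrite -ball_normE/=.
  rewrite (_ : z - y = (z - lattice_point t) - (y - lattice_point t)); last first.
    by rewrite opprB addrA subrK.
  rewrite (le_lt_trans (ler_normB _ _))// (splitr e) ltrD//.
    exact: le_lt_trans em.
  exact: le_lt_trans em.
have : ([set z | `|z - lattice_point t| <= m.+1%:R^-1] `&` lattice) z by [].
by rewrite -cylinder_ballE => -[].
Qed.

Lemma borel_cylinder (A : set (borel E)) : measurable A ->
  exists2 B, <<s cylinder_family >> B & A `&` lattice = B `&` lattice.
Proof.
pose G := [set A : set (borel E) |
  exists2 B, <<s cylinder_family >> B & A `&` lattice = B `&` lattice].
suff : <<s @open E >> `<=` G by move=> h /h.
apply: smallest_sub; last by move=> U; exact: open_cylinder.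
split.
- by exists set0; first exact: sigma_algebra0.
- move=> B [C sC BC]; exists (~` C); first exact: sigma_algebraC.
  rewrite setTD; apply/seteqP; split=> z [zX zL]; split=> // zY; apply: zX.
    by have : (C `&` lattice) z by []; rewrite -BC => -[].
  by have : (B `&` lattice) z by []; rewrite BC => -[].
- move=> F FG.
  have FG' n : exists B, <<s cylinder_family >> B /\ F n `&` lattice = B `&` lattice.
    by have [B sB FB] := FG n; exists B.
  have [C CF] := choice FG'; exists (\bigcup_n C n).
    by apply: sigma_algebra_bigcup => n; have [] := CF n.
  by rewrite !setI_bigcupl; apply: eq_bigcupr => n _; have [] := CF n.
Qed.

(** * The shift preserves the measure and is mixing *)

(** Both sides are continuous functionals in the point z, and they agree on the
    jumps. *)
Lemma shift_jump_count n (z : E) : jump_count n (T z) = jump_count n.+1 z.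
Proof.
apply: (dual_ext (f := adjoint cT (jump_count n)) (g := jump_count n.+1)) => k.
apply: (mulfI (lt0r_neq0 (lam_gt0 k))); rewrite adjoint_jump jump_count_jump.
by case: k => // l; rewrite jump_count_jump eqSS.
Qed.

(** Fixes the type of the iterates, so that preimages are taken between the
    measurable spaces. *)
Definition shift_iter n : borel E -> borel E := iter n T.

Lemma iter_shift_jump_count n i z : jump_count i (shift_iter n z) = jump_count (n + i) z.
Proof.
elim: n i => // n IH i.
by rewrite /shift_iter iterS shift_jump_count [LHS]IH addnS. Qed.

Lemma iter_shift_measurable n : measurable_fun [set: borel E] (shift_iter n).
Proof.
elim: n => [|n IH]; first exact: measurable_id.
apply: (measurableT_comp (f := (T : borel E -> borel E))) IH.
exact: borel_continuous.
Qed.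

Lemma preimage_shift_measurable n (A : set (borel E)) : measurable A ->
  measurable (shift_iter n @^-1` A).
Proof.
by move=> mA; rewrite -[X in measurable X]setTI; exact: iter_shift_measurable.
Qed.

Lemma preimage_shift_cylinder n I k : shift_iter n @^-1` cylinder I k =
  cylinder (map (addn n) I) (fun i => k (i - n)%N).
Proof.
apply/seteqP; split=> z /= h i.
  by move=> /mapP[j jI ->]; rewrite addKn -iter_shift_jump_count; exact: h.
move=> iI; rewrite iter_shift_jump_count h ?addKn//.
by apply: map_f.
Qed.

Lemma lattice_shift n : lattice `<=` shift_iter n @^-1` lattice.
Proof. by move=> z zL i; rewrite iter_shift_jump_count. Qed.

Lemma cylinder_undup I k : cylinder (undup I) k = cylinder I k.
Proof.
by apply/seteqP; split=> z h i iI; apply: h; rewrite mem_undup in iI *.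
Qed.

Lemma preimage_setI_lattice n (A B : set (borel E)) :
  A `&` lattice = B `&` lattice ->
  shift_iter n @^-1` A `&` lattice = shift_iter n @^-1` B `&` lattice.
Proof.
have sub (C D : set (borel E)) : C `&` lattice = D `&` lattice ->
    shift_iter n @^-1` C `&` lattice `<=` shift_iter n @^-1` D `&` lattice.
  move=> CD z [zC zL]; split => //.
  have : (C `&` lattice) (iter n T z) by split=> //; exact: lattice_shift.
  by rewrite CD => -[].
by move=> AB; apply/seteqP; split; apply: sub.
Qed.

(** On a cylinder, the shift only translates the indices, and the mass of a
    cylinder does not depend on them. *)
Lemma shift_invariant : invariant_measure mu T.
Proof.
move=> A mA; have [B sB AB] := borel_cylinder mA.
have mB := cylinder_family_sigma sB.
rewrite (mu_eq_on_lattice mA mB AB).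
have := preimage_setI_lattice 1 AB => /= AB1.
rewrite (mu_eq_on_lattice _ _ AB1); try exact: (@preimage_shift_measurable 1).
move: B sB {AB mB AB1}; apply: preserved_on_sigma_algebra.
- exact: (iter_shift_measurable 1).
- exact: cylinder_familyI.
- exact: cylinder_family_measurable.
move=> B [->|[I [k ->]]]; first by rewrite preimage_set0.
rewrite (preimage_shift_cylinder 1).
rewrite -(fineK (fin_num_measure mu _ (cylinder_measurable _ _))).
rewrite -[RHS](fineK (fin_num_measure mu _ (cylinder_measurable _ _))).
congr EFin; rewrite -[in LHS]cylinder_undup -[in RHS]cylinder_undup.
rewrite !cylinder_mass ?undup_uniq//.
rewrite undup_map_inj ?big_map; last by move=> i j /addnI.
by apply: eq_bigr => i _; rewrite addKn.
Qed.

Lemma shift_iter_preserves n (A : set (borel E)) : measurable A ->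
  mu (shift_iter n @^-1` A) = mu A.
Proof.
elim: n A => // n IH A mA; rewrite -[RHS](shift_invariant mA).
exact: IH (preimage_shift_measurable 1 mA).
Qed.

Lemma dominated_content_setIr (C : set (borel E)) : measurable C ->
  dominated_content mu (fun A => fine (mu (A `&` C))).
Proof.
move=> mC; split=> [A mA|A B mA mB AB].
  have mAC : measurable (A `&` C) by exact: measurableI.
  by rewrite fine_ge0//= fine_le ?fin_num_measure// le_measure ?inE.
have mAC : measurable (A `&` C) by exact: measurableI.
have mBC : measurable (B `&` C) by exact: measurableI.
rewrite setIUl measureU ?fineD ?fin_num_measure//.
by rewrite setIACA AB set0I.
Qed.

Lemma dominated_content_preimage n (A : set (borel E)) : measurable A ->
  dominated_content mu (fun B => fine (mu (A `&` shift_iter n @^-1` B))).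
Proof.
move=> mA; split=> [B mB|B C mB mC BC].
  have mB' := preimage_shift_measurable n mB.
  have mAB : measurable (A `&` shift_iter n @^-1` B) by exact: measurableI.
  rewrite fine_ge0//= fine_le ?fin_num_measure// -(shift_iter_preserves n mB).
  by rewrite le_measure ?inE.
have mB' := preimage_shift_measurable n mB.
have mC' := preimage_shift_measurable n mC.
have mAB : measurable (A `&` shift_iter n @^-1` B) by exact: measurableI.
have mAC : measurable (A `&` shift_iter n @^-1` C) by exact: measurableI.
rewrite preimage_setU setIUr measureU ?fineD ?fin_num_measure//.
rewrite -subset0 => z [[_ zB] [_ zC]].
have : (B `&` C) (shift_iter n z) by [].
by rewrite BC.
Qed.

Lemma dominated_content_scale (c : R) : 0 <= c <= 1 ->
  dominated_content mu (fun A => c * fine (mu A)).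
Proof.
move=> /andP[c0 c1]; split=> [A mA|A B mA mB AB].
  have A0 : 0 <= fine (mu A) by rewrite fine_ge0.
  by rewrite mulr_ge0//= ler_piMl.
by rewrite measureU// fineD ?mulrDr// fin_num_measure.
Qed.

Lemma fine_probability_itv (A : set (borel E)) : measurable A ->
  0 <= fine (mu A) <= 1.
Proof.
move=> mA; rewrite fine_ge0//= -lee_fin fineK ?fin_num_measure//.
exact: probability_le1.
Qed.

(** Once n exceeds every index of A, the indices of A and the translated indices
    of B are disjoint, and the masses multiply. *)
Lemma mixing_cylinder (A B : set (borel E)) : cylinder_family A -> cylinder_family B ->
  fine (mu (A `&` shift_iter n @^-1` B)) @[n --> \oo] -->
  fine (mu A) * fine (mu B).
Proof.
move=> [->|[I [k ->]]].
  move=> _; rewrite measure0 mul0r.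
  by under eq_cvg do rewrite set0I measure0; exact: cvg_cst.
move=> [->|[J [l ->]]].
  rewrite measure0 mulr0.
  by under eq_cvg do rewrite preimage_set0 setI0 measure0; exact: cvg_cst.
rewrite -(cylinder_undup I) -(cylinder_undup J).
have := undup_uniq I; have := undup_uniq J.
move: (undup I) (undup J) => {}I {}J uJ uI.
apply: (@cvg_trans _ ((fine (mu (cylinder I k)) * fine (mu (cylinder J l)))
  @[n --> \oo])); last exact: cvg_cst.
apply: near_eq_cvg; near=> n.
have In i : i \in I -> (i < n)%N.
  move=> iI; apply: (@leq_ltn_trans (\max_(i <- I) i)).
    exact: leq_bigmax_seq.
  by near: n; exact: nbhs_infty_gt.
have mI i j : i \in I -> (i != n + j)%N.
  by move=> /In; apply: contraTN => /eqP ->; rewrite -leqNgt leq_addr.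
(* Prescribes k on the indices of I and the translate of l on those of J. *)
pose kl i := if (i < n)%N then k i else l (i - n)%N.
have -> : cylinder I k `&` shift_iter n @^-1` cylinder J l =
    cylinder (I ++ map (addn n) J) kl.
  rewrite preimage_shift_cylinder; apply/seteqP; split=> [z [zI zJ] i|z zIJ].
    rewrite mem_cat /kl => /orP[iI|iJ]; first by rewrite In//; exact: zI.
    by have /mapP[j _ ij] := iJ; rewrite zJ// ij ltnNge leq_addr.
  split=> i iX; rewrite zIJ ?mem_cat ?iX ?orbT// /kl; first by rewrite In.
  by have /mapP[j _ ->] := iX; rewrite ltnNge leq_addr.
rewrite !cylinder_mass// ?cat_uniq ?uI ?map_inj_uniq ?uJ ?andbT/=; last 2 first.
- by apply/hasPn => _ /mapP[j _ ->]; apply/negP => /(mI _ j); rewrite eqxx.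
- by move=> i j /addnI.
rewrite big_cat/= big_map; congr (_ * _).
  by rewrite !big_seq; apply: eq_bigr => i iI; rewrite /kl In.
by apply: eq_bigr => j _; rewrite /kl ltnNge leq_addr/= addKn.
Unshelve. all: by end_near. Qed.

(** Extend the second set from cylinders last: for a cylinder B, the contents
    A -> mu (A `&` T^-n B) converge on all A; then, for a fixed A, so do the
    contents B -> mu (A `&` T^-n B), dominated by mu through invariance. *)
Lemma mixing_cylinder_sigma (A B : set (borel E)) :
    <<s cylinder_family >> A -> <<s cylinder_family >> B ->
  fine (mu (A `&` shift_iter n @^-1` B)) @[n --> \oo] -->
  fine (mu A) * fine (mu B).
Proof.
have T1 : fine (mu setT) = 1 by rewrite [X in fine X]probability_setT.
have step1 (C D : set (borel E)) : <<s cylinder_family >> C -> cylinder_family D ->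
    fine (mu (C `&` shift_iter n @^-1` D)) @[n --> \oo] -->
    fine (mu C) * fine (mu D).
  move=> sC cD; have mD := cylinder_family_measurable cD.
  rewrite mulrC.
  apply: (@dominated_content_cvg _ _ _ mu
    (fun n C => fine (mu (C `&` shift_iter n @^-1` D)))
    (fun C => fine (mu D) * fine (mu C)) cylinder_family) => //.
  - exact: cylinder_familyI.
  - exact: cylinder_family_measurable.
  - move=> n; apply: dominated_content_setIr.
    exact: preimage_shift_measurable.
  - by apply: dominated_content_scale; exact: fine_probability_itv.
  - rewrite T1 mulr1; under eq_cvg do rewrite setTI shift_iter_preserves//.
    exact: cvg_cst.
  - by move=> C' cC'; rewrite mulrC; exact: mixing_cylinder.
move=> sA sB; have mA := cylinder_family_sigma sA.
apply: (@dominated_content_cvg _ _ _ mu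
  (fun n B => fine (mu (A `&` shift_iter n @^-1` B)))
  (fun B => fine (mu A) * fine (mu B)) cylinder_family) => //.
- exact: cylinder_familyI.
- exact: cylinder_family_measurable.
- by move=> n; exact: dominated_content_preimage.
- by apply: dominated_content_scale; exact: fine_probability_itv.
- rewrite T1 mulr1; under eq_cvg do rewrite preimage_setT setIT.
  exact: cvg_cst.
- by move=> D cD; exact: step1.
Qed.

(** Replace both sets by the sets of the sigma-algebra of the cylinders that agree
    with them on the lattice, which has full measure and is stable under the shift. *)
Lemma shift_mixing : mixing mu T.
Proof.
move=> A B mA mB.
have [A' sA AA] := borel_cylinder mA; have [B' sB BB] := borel_cylinder mB.
have mA' := cylinder_family_sigma sA; have mB' := cylinder_family_sigma sB.
rewrite (mu_eq_on_lattice mA mA' AA) (mu_eq_on_lattice mB mB' BB).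
rewrite -(fineK (fin_num_measure mu _ mA')) -(fineK (fin_num_measure mu _ mB')).
rewrite -EFinM (_ : (fun n => _) =
  EFin \o (fun n => fine (mu (A' `&` shift_iter n @^-1` B')))).
  by apply/fine_cvgP; split; [exact: nearW|exact: mixing_cylinder_sigma].
apply/funext => n /=.
have mn := preimage_shift_measurable n mB.
have mn' := preimage_shift_measurable n mB'.
rewrite fineK; last by apply: fin_num_measure; exact: measurableI.
apply: mu_eq_on_lattice; [exact: measurableI|exact: measurableI|].
rewrite -[lattice]setIid setIACA AA.
by rewrite (preimage_setI_lattice n BB) -setIACA.
Qed.

End characteristic_exponent.

Theorem proposition4p3 (R : realType) (p : R) (p1 : 1 <= p) (p2 : p < 2)
    (omega : nat -> R) (omega_gt0 : forall n, 0 < omega n)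
    (lam : nat -> R) (lam0_gt0 : 0 < lam 0%N)
    (lamE : forall n, lam n = lam 0%N * \prod_(l < n) (1 / omega l))
    (lam_ellp : lam \in Lfun (nat_counting R) p%:E)
    (mu : probability (borel (ellp p1)) R)
    (mu_charfun : forall f : dual (ellp p1),
      charfun mu f =
      cexp (levy_khintchine
        (limn (series (fun n => lam n *: ellp_basis p1 n)))
        \1_[set z : ellp p1 | `|z| <= sup (range lam)]
        (sum_dirac (fun n => lam n *: ellp_basis p1 n))
        f))
    (T : {linear ellp p1 -> ellp p1}) (cT : continuous T)
    (T0 : T (ellp_basis p1 0) = 0)
    (TS : forall n, T (ellp_basis p1 n.+1) = omega n *: ellp_basis p1 n) :
  [/\ invariant_measure mu T,
      forall n : nat,
        (ereal_sup
          [set (ComplexField.Normc.normc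
                  (codifference mu f (iter n (adjoint cT) g)) /
                (`|f| `^ (p / 2) * `|g| `^ (p / 2)))%R%:E |
            f in [set f : dual (ellp p1) | (f != 0)%R] &
            g in [set g : dual (ellp p1) | (g != 0)%R]]
         <= (2 `^ (4 - p))%R%:E *
            \sum_(0 <= l <oo) ((lam l * lam (l + n)%N) `^ (p / 2))%R%:E)%E
    & (\sum_(0 <= l <oo) ((lam l * lam (l + n)%N) `^ (p / 2))%R%:E)%E
        @[n --> \oo] --> 0%E ->
      mixing mu T].
Proof.
have lam_gt0 n : 0 < lam n.
  by rewrite lamE mulr_gt0// prodr_gt0// => i _; rewrite divr_gt0.
have lamS n : lam n.+1 * omega n = lam n.
  by rewrite lamE big_ord_recr/= [in RHS]lamE mul1r !mulrA mulfVK// gt_eqF.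
have mu_exponent f : charfun mu f = cexp (exponent lam f) by exact: mu_charfun.
have invariant := shift_invariant p2 lam_gt0 lam_ellp mu_exponent lamS cT T0 TS.
have mix := shift_mixing p2 lam_gt0 lam_ellp mu_exponent lamS cT T0 TS.
have bound :=
  codifference_adjoint_le p2 lam_gt0 lam_ellp mu_exponent lamS cT T0 TS.
clear mu_charfun mu_exponent.
split; [exact: invariant| |by move=> _; exact: mix].
move=> n; apply: ge_ereal_sup => _ [f f0 [g g0 <-]].
have fg0 : 0 < `|f| `^ (p / 2) * `|g| `^ (p / 2).
  by rewrite mulr_gt0// powR_gt0// normr_gt0.
rewrite EFinM lee_pdivrMr//.
apply: (le_trans (bound n f g)); rewrite muleAC -EFinM.
apply: lee_wpmul2r.
  by apply: nneseries_ge0 => l _ _; rewrite lee_fin powR_ge0.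
rewrite lee_fin ler_wpM2r ?(ltW fg0)// ler_powR//; lra.
Qed.
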